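(* Let $G$ be a second countable locally compact abelian group, let $\Lambda\subset G\times\widehat G$ be a lattice (a discrete cocompact subgroup), and let $n,d\in\mathbb N$. Let $E$ be the Heisenberg module of $\Lambda$. If $g\in M_{n,d}(E)$ is such that $\mathcal G(g;\Lambda)$ is an $(n,d)$-matrix Gabor Riesz sequence for $L^2(G)$, then $$s(\Lambda)\ge\frac nd .$$
   Context: Haar measures on $G$ and $\widehat G$ are normalized so that the Plancherel theorem holds; $\Lambda$ carries counting measure, and $(G\times\widehat G)/\Lambda$ the Haar measure for which Weil's formula $\int_{G\times\widehat G}f=\int_{(G\times\widehat G)/\Lambda}\int_\Lambda f(\xi+\lambda)\,d\lambda\,d\dot\xi$ holds. The size of $\Lambda$ is $s(\Lambda)=\int_{(G\times\widehat G)/\Lambda}1$. For $\xi=(x,\omega)\in G\times\widehat G$, $\pi(\xi)f(t)=\omega(t)f(t-x)$ on $L^2(G)$. For an LCA group $H$, the Feichtinger algebra is $S_0(H)=\{f\in L^2(H): V_ff\in L^1(H\times\widehat H)\}$, $V_gf(\xi)=\langle f,\pi(\xi)g\rangle$. Let $A\subset\mathbb B(L^2(G))$ be the norm closure of $\{\int_\Lambda a(\lambda)\pi(\lambda)\,d\lambda: a\in S_0(\Lambda)\}$ (the twisted group $C^*$-algebra of $\Lambda$). The Heisenberg module $E$ is the completion of $S_0(G)$ in the norm $\|{}_\bullet\langle f,f\rangle\|^{1/2}$, where ${}_\bullet\langle f,g\rangle=\int_\Lambda\langle f,\pi(\lambda)g\rangle\pi(\lambda)\,d\lambda\in A$. The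 inclusion $S_0(G)\subset L^2(G)$ extends to a continuous injection $E\hookrightarrow L^2(G)$, by which $E$ is regarded as a subspace of $L^2(G)$ and $M_{n,d}(E)$ ($n\times d$ matrices over $E$, rows indexed by $\mathbb Z_n=\mathbb Z/n\mathbb Z$, columns by $\mathbb Z_d$) as a subspace of $L^2(G\times\mathbb Z_n\times\mathbb Z_d)$, writing $f_{i,j}=f(\cdot,i,j)$. For $g\in M_{n,d}(E)$ let $\mathcal G(g;\Lambda)=\{\pi(\lambda)g_{i,j}:\lambda\in\Lambda\}_{i\in\mathbb Z_n,j\in\mathbb Z_d}$ and let $C_g:L^2(G\times\mathbb Z_n\times\mathbb Z_d)\to L^2(\Lambda\times\mathbb Z_n\times\mathbb Z_n)$ be the (bounded) operator $(C_gf)_{k,l}(\lambda)=\sum_{m\in\mathbb Z_d}\langle f_{k,m},\pi(\lambda)g_{l,m}\rangle$. $\mathcal G(g;\Lambda)$ is an $(n,d)$-matrix Gabor Riesz sequence for $L^2(G)$ if $C_gC_g^*$ is an isomorphism of $L^2(\Lambda\times\mathbb Z_n\times\mathbb Z_n)$. *)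

(* Defs.v *)
From HB Require Import structures.
From mathcomp Require Import all_boot all_order all_algebra.
From mathcomp Require Import generic_quotient ring_quotient complex.
From mathcomp Require Import all_classical all_reals all_analysis.

Set Implicit Arguments.
Unset Strict Implicit.
Unset Printing Implicit Defensive.

Import Order.TTheory GRing.Theory Num.Theory.
Import numFieldTopology.Exports numFieldNormedType.Exports.

Local Open Scope classical_set_scope.
Local Open Scope ring_scope.
Local Open Scope complex_scope.

(* [borel T] is [T] with its Borel sigma-algebra, pointed at [0]. *)
Definition borel (T : PreTopologicalZmodule.type) : Type := T.

Section borel.
Variable T : PreTopologicalZmodule.type.
HB.instance Definition _ := Choice.copy (borel T) T.
HB.instance Definition _ := isPointed.Build (borel T) (0 : T).
Let opens : set (set (borel T)) := @open T.
HB.instance Definition _ := @isMeasurable.Build (sigma_display opens)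
  (borel T) <<s opens >> (@sigma_algebra0 _ setT opens)
  (@sigma_algebraC (borel T) opens) (@sigma_algebra_bigcup _ setT opens).
End borel.

Section haar.
Context {R : realType} {T : PreTopologicalZmodule.type}.
Variable mu : {measure set (borel T) -> \bar R}.

(* Regularity is not required: on a second countable locally compact Hausdorff
   group every Borel measure that is finite on compact sets is regular. *)
Definition haar_measure : Prop :=
  [/\ forall K : set T, compact K -> (mu K < +oo)%E,
      forall (x : T) (A : set (borel T)), measurable A ->
        mu [set (x + y : T) | y in A] = mu A
    & mu setT <> 0%E].
End haar.

Section dual.
Variables (R : realType) (G : PreTopologicalZmodule.type).

Record dual : Type := Dual {
  char_fun :> G -> R[i] ;
  char_continuous : continuous (char_fun : G -> R[i]^o) ;
  char_norm : forall x, `|char_fun x| = 1 ;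
  charD : forall x y, char_fun (x + y) = char_fun x * char_fun y }.

Lemma dual_eq (a b : dual) : (a : G -> R[i]) =1 b -> a = b.
Proof.
case: a b => [f f1 f2 f3] [g g1 g2 g3] /= /funext fg.
by case: _ / fg in g1 g2 g3 *; congr Dual; exact: Prop_irrelevance.
Qed.

HB.instance Definition _ := gen_eqMixin dual.
HB.instance Definition _ := gen_choiceMixin dual.

Lemma char_neq0 (a : dual) x : a x != 0.
Proof. by rewrite -normr_eq0 char_norm oner_eq0. Qed.

Definition dual_one : dual.
Proof.
exists (fun=> 1); first exact: cst_continuous.
- by move=> x; rewrite normr1.
- by move=> x y; rewrite mulr1.
Defined.

Definition dual_mul (a b : dual) : dual.
Proof.
exists (fun x => a x * b x).
- move=> x; exact: (@cvgM R[i] G _ _ a b (a x) (b x)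
    (@char_continuous a x) (@char_continuous b x)).
- by move=> x; rewrite normrM !char_norm mulr1.
- by move=> x y; rewrite !charD mulrACA.
Defined.

Definition dual_inv (a : dual) : dual.
Proof.
exists (fun x => (a x)^-1).
- move=> x; exact: (@cvgV R[i] G _ _ a (a x) (char_neq0 a x)
    (@char_continuous a x)).
- by move=> x; rewrite normfV char_norm invr1.
- by move=> x y; rewrite charD invfM.
Defined.

Lemma dual_mulA : associative dual_mul.
Proof. by move=> a b c; apply: dual_eq => x /=; rewrite mulrA. Qed.
Lemma dual_mulC : commutative dual_mul.
Proof. by move=> a b; apply: dual_eq => x /=; rewrite mulrC. Qed.
Lemma dual_mul1 : left_id dual_one dual_mul.
Proof. by move=> a; apply: dual_eq => x /=; rewrite mul1r. Qed.
Lemma dual_mulV : left_inverse dual_one dual_inv dual_mul.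
Proof. by move=> a; apply: dual_eq => x /=; rewrite mulVf// char_neq0. Qed.

(* Pointwise multiplication of characters is written additively. *)
HB.instance Definition _ :=
  GRing.isZmodule.Build dual dual_mulA dual_mulC dual_mul1 dual_mulV.

HB.instance Definition _ := Topological.copy dual
  (initial_topology (char_fun : dual -> {compact-open, G -> R[i]^o})).
End dual.

Section lattice.
Context {R : realType} {G : PreTopologicalZmodule.type}.
Variable L : zmodClosed (G * dual R G)%type.

(* The subgroup L as a type, with the discrete sigma-algebra. *)
Definition points : Type := {x : G * dual R G | x \in L}.
HB.instance Definition _ := Choice.on points.
HB.instance Definition _ :=
  isPointed.Build points (exist (fun x => x \in L) 0 (rpred0 L)).
HB.instance Definition _ := @isMeasurable.Build default_measure_display
  points discrete_measurable discrete_measurable0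
  discrete_measurableC discrete_measurableU.

Definition phase_quot : Type := quotient_topology (Quotient.quot L).
HB.instance Definition _ :=
  Topological.copy phase_quot (quotient_topology (Quotient.quot L)).
HB.instance Definition _ := Quotient.copy phase_quot (Quotient.quot L).
HB.instance Definition _ := GRing.isZmodule.Build phase_quot
  (@addrA (Quotient.quot L)) (@addrC (Quotient.quot L))
  (@add0r (Quotient.quot L)) (@addNr (Quotient.quot L)).

Definition is_lattice : Prop :=
  (forall l, l \in L -> exists2 U, nbhs l U & U `&` [set` L] = [set l]) /\
  compact [set: phase_quot].
End lattice.

Section complex_Lp.
Context d {T : measurableType d} {R : realType}.
Variable mu : {measure set T -> \bar R}.
Implicit Types f h : T -> R[i].

Definition cmeasurable f : Prop :=
  measurable_fun setT (fun x => complex.Re (f x)) /\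
  measurable_fun setT (fun x => complex.Im (f x)).

(* The parts of a non-integrable f contribute the default values of Rintegral;
   this is only used for integrable f, or almost everywhere. *)
Definition cintegral f : R[i] :=
  (\int[mu]_x complex.Re (f x)) +i* (\int[mu]_x complex.Im (f x)).

Definition cLnorm (p : \bar R) f : \bar R :=
  Lnorm mu p (fun x => (ComplexField.Normc.normc (f x))%:E).

Definition memL (p : \bar R) f : Prop := cmeasurable f /\ (cLnorm p f < +oo)%E.

Definition inner f h : R[i] := cintegral (fun x => f x * (h x)^*).

(* The norm of an operator on L^2(mu), acting on representatives. *)
Definition opnorm (S : (T -> R[i]) -> (T -> R[i])) : \bar R :=
  ereal_sup [set cLnorm 2%:E (S h) | h in
              [set h | memL 2%:E h /\ (cLnorm 2%:E h <= 1)%E]].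

(* L^2(T x Z_n x Z_m), as n x m matrices over L^2(T). *)
Section matrix.
Variables n m : nat.
Implicit Types a b : 'M[T -> R[i]]_(n, m).

Definition mxmemL2 a : Prop := forall i j, memL 2%:E (a i j).

Definition mxinner a b : R[i] := \sum_i \sum_j inner (a i j) (b i j).

Definition mxL2norm a : \bar R :=
  ((\sum_i \sum_j cLnorm 2%:E (a i j) `^ 2) `^ 2^-1)%E.

Definition mxlincomb (c : R[i]) a b : 'M[T -> R[i]]_(n, m) :=
  \matrix_(i, j) (fun x => c * a i j x + b i j x).
End matrix.
End complex_Lp.

Section gabor.
Context {R : realType} {G : PreTopologicalZmodule.type}.
Variables (mu : {sigma_finite_measure set (borel G) -> \bar R})
          (muhat : {sigma_finite_measure set (borel (dual R G)) -> \bar R}).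
Implicit Types (f g h : G -> R[i]) (xi : G * dual R G).

Definition fourier f (w : dual R G) : R[i] :=
  cintegral mu (fun t => f t * (w t)^*).

Definition plancherel : Prop :=
  forall f, memL mu 1%:E f -> memL mu 2%:E f ->
    cLnorm muhat 2%:E (fourier f) = cLnorm mu 2%:E f.

Definition tfshift xi f : G -> R[i] := fun t => xi.2 t * f (t - xi.1).

Definition stft g f xi : R[i] := inner mu f (tfshift xi g).

(* The Haar measure of the phase space is the product measure; its sigma-algebra
   is the Borel one because G and its dual are second countable. *)
Definition feichtinger f : Prop :=
  memL mu 2%:E f /\ memL (mu \x muhat)%E 1%:E (stft f f).

Variable L : zmodClosed (G * dual R G)%type.

Definition lattice_sum (a : points L -> R[i]) : R[i] :=
  cintegral (@counting (points L) R) a.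

Definition weil (nu : {measure set (borel (phase_quot L)) -> \bar R}) : Prop :=
  forall F : G * dual R G -> R[i], memL (mu \x muhat)%E 1%:E F ->
    cintegral (mu \x muhat)%E F =
    cintegral nu (fun q => lattice_sum (fun l => F (repr q + val l))).

(* For a in l^1(L), the integral of a(l) pi(l) over L as an operator of L^2(G):
   for h in L^2(G) the sum below converges absolutely for almost every t, and
   its value is that of the norm convergent integral. *)
Definition integrated (a : points L -> R[i]) h : G -> R[i] :=
  fun t => lattice_sum (fun l => a l * tfshift (val l) h t).

Definition lbracket f g : (G -> R[i]) -> (G -> R[i]) :=
  integrated (fun l => inner mu f (tfshift (val l) g)).

(* The C*-algebra of L is normed by the operator norm of L^2(G). *)
Definition heisenberg_norm f : \bar R := (opnorm mu (lbracket f f) `^ 2^-1)%E.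

(* The elements of L^2(G) in the image of the completion of the Feichtinger
   algebra for the Heisenberg norm: the class of a Cauchy sequence is mapped to
   its limit in L^2(G). *)
Definition heisenberg f : Prop :=
  memL mu 2%:E f /\
  exists u : nat -> G -> R[i],
    [/\ forall k, feichtinger (u k),
        forall e : R, 0 < e -> exists N, forall k l, (N <= k)%N -> (N <= l)%N ->
          (heisenberg_norm (fun x => (u k x - u l x)%R) <= e%:E)%E
      & cLnorm mu 2%:E (fun x => u k x - f x) @[k --> \oo] --> 0%E].

Section riesz.
Variables (n d : nat) (g : 'M[G -> R[i]]_(n, d)).

Definition analysis (f : 'M[G -> R[i]]_(n, d)) : 'M[points L -> R[i]]_(n, n) :=
  \matrix_(k, l) (fun z => \sum_m inner mu (f k m) (tfshift (val z) (g l m))).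

Local Notation counting := (@counting (points L) R).

(* D is the adjoint of the analysis operator; its values are determined almost
   everywhere, which is all the analysis operator sees. *)
Definition analysis_adjoint
    (D : 'M[points L -> R[i]]_(n, n) -> 'M[G -> R[i]]_(n, d)) : Prop :=
  forall a, mxmemL2 counting a -> mxmemL2 mu (D a) /\
    forall f : 'M[G -> R[i]]_(n, d), mxmemL2 mu f ->
      mxinner counting (analysis f) a = mxinner mu f (D a).

(* L^2(L x Z_n x Z_n) has no nonempty null sets, hence its elements are
   functions. *)
Definition l2_isomorphism
    (S : 'M[points L -> R[i]]_(n, n) -> 'M[points L -> R[i]]_(n, n)) : Prop :=
  let l2 := mxmemL2 counting (n:=n) (m:=n) in
  let norm := mxL2norm counting (n:=n) (m:=n) in
  [/\ forall c a b, l2 a -> l2 b ->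
        S (mxlincomb c a b) = mxlincomb c (S a) (S b),
      set_bij l2 l2 S
    & exists2 K : R, 0 < K & forall a, l2 a ->
        (norm (S a) <= K%:E * norm a)%E /\ (norm a <= K%:E * norm (S a))%E].

Definition matrix_gabor_riesz : Prop :=
  exists2 D, analysis_adjoint D & l2_isomorphism (analysis \o D).
End riesz.
End gabor.

Definition lattice_size {R : realType} {G : PreTopologicalZmodule.type}
    (L : zmodClosed (G * dual R G)%type)
    (nu : {measure set (borel (phase_quot L)) -> \bar R}) : \bar R :=
  (\int[nu]_q 1)%E.

(* Main.v *)
Require Import Defs.
From HB Require Import structures.
From mathcomp Require Import all_boot all_order all_algebra complex.
From mathcomp Require Import all_classical all_reals all_analysis.
From mathcomp Require Import finmap measurable_realfun ring lra.

Set Implicit Arguments.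
Unset Strict Implicit.
Unset Printing Implicit Defensive.

Import Order.TTheory GRing.Theory Num.Theory.
Import numFieldTopology.Exports numFieldNormedType.Exports.
Local Open Scope classical_set_scope.
Local Open Scope ring_scope.
Local Open Scope complex_scope.

(** Let phi be the indicator function of a set A with 0 < mu A < +oo and let
    F_h(xi) = <phi, pi(xi) h> be its short-time Fourier transform with window
    h. Suppose first that the rows g_l of g generate an orthonormal system
    {pi(z) g_l} of L^2(G)^d. For every column j and every point xi of the
    phase space, Bessel's inequality for the vector with the single entry
    pi(xi)^* phi in column j reads
      sum_l sum_z |F_(g_lj)(xi + z)|^2 <= |phi|^2,    z in the lattice.
    Integrating over the quotient by Weil's formula, and using Moyal's relation
    int |F_h|^2 = |phi|^2 |h|^2, gives sum_l |g_lj|^2 <= s. Summation over the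
    d columns yields n <= d s.

    For a Riesz sequence, orthonormality is replaced by biorthogonality: the
    surjectivity of the Gram operator C C^* provides h with <pi(z) h_l, g_k> equal to 1 if z = 0 and
    k = l, and to 0 otherwise, and with h_l in the range of C^*
    ([dual_window]). The sum over the lattice of <psi, pi(z) g_l> times the
    conjugate of <psi, pi(z) h_l> is then the squared norm of the orthogonal
    projection of psi onto the span of the pi(z) g_l. It lies between 0 and
    |psi|^2, and the argument above applies to F_(g_lj) conj(F_(h_lj)) in place
    of |F_(g_lj)|^2 ([biorthogonal_column_bound]); on the left-hand side, the
    sum over j and l of <g_lj, h_lj> is n.

    Two points of measure theory support this. Moyal's relation
    ([stft_energy]) is Plancherel's theorem in the frequency variable followed
    by Tonelli's theorem and translation invariance; it needs F_h to be jointly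
    measurable, which rests on [separately_continuous_measurable] applied to
    the duality pairing. On the quotient, the sums over cosets of the lattice
    are nonnegative and bounded by |phi|^2, and their integral is bounded by
    monotonicity of the supremum over simple functions that defines it
    ([ge0_le_lower_integral]). *)

Local Notation Re := complex.Re.
Local Notation Im := complex.Im.
Local Notation "z ^*" := (Num.conj z) : complex_scope.

(** * Complex numbers *)

Section complex_numbers.
Variable R : realType.
Implicit Types z w : R[i].

Definition normsq z : R := Re z ^+ 2 + Im z ^+ 2.

Lemma complexP z w : Re z = Re w -> Im z = Im w -> z = w.
Proof. by case: z w => a b [c d] /= -> ->. Qed.
Lemma ReD z w : Re (z + w) = Re z + Re w. Proof. by case: z w => ? ? []. Qed.
Lemma ImD z w : Im (z + w) = Im z + Im w. Proof. by case: z w => ? ? []. Qed.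
Lemma ReN z : Re (- z) = - Re z. Proof. by case: z. Qed.
Lemma ImN z : Im (- z) = - Im z. Proof. by case: z. Qed.
Lemma ReM z w : Re (z * w) = Re z * Re w - Im z * Im w.
Proof. by case: z w => ? ? []. Qed.
Lemma ImM z w : Im (z * w) = Re z * Im w + Im z * Re w.
Proof. by case: z w => ? ? []. Qed.
Lemma ReJ z : Re z^* = Re z. Proof. by case: z. Qed.
Lemma ImJ z : Im z^* = - Im z. Proof. by case: z. Qed.
Lemma Re_real (r : R) : Re r%:C = r. Proof. by []. Qed.
Lemma Im_real (r : R) : Im r%:C = 0. Proof. by []. Qed.
Lemma Re0 : Re (0 : R[i]) = 0. Proof. by []. Qed.
Lemma Re1 : Re (1 : R[i]) = 1. Proof. by []. Qed.
Lemma Im1 : Im (1 : R[i]) = 0. Proof. by []. Qed.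
Definition cpxE := (ReD, ImD, ReN, ImN, ReM, ImM, ReJ, ImJ).

Lemma Re_sum (I : Type) (r : seq I) (P : pred I) (F : I -> R[i]) :
  Re (\sum_(i <- r | P i) F i) = \sum_(i <- r | P i) Re (F i).
Proof. exact: (big_morph _ ReD Re0). Qed.

Lemma normsq_ge0 z : 0 <= normsq z.
Proof. by rewrite addr_ge0// sqr_ge0. Qed.

Lemma normsqM z w : normsq (z * w) = normsq z * normsq w.
Proof. rewrite /normsq !cpxE; ring. Qed.

Lemma normsqJ z : normsq z^* = normsq z.
Proof. by rewrite /normsq !cpxE sqrrN. Qed.

Lemma normsq0 : normsq 0 = 0.
Proof. by rewrite /normsq /= expr0n /= addr0. Qed.

Lemma normcE z : ComplexField.Normc.normc z = Num.sqrt (normsq z).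
Proof. by case: z. Qed.

Lemma normr1_normsq z : `|z| = 1 -> normsq z = 1.
Proof.
rewrite normc_def => /complexI e.
by rewrite -[LHS]sqr_sqrtr ?normsq_ge0// e expr1n.
Qed.

Lemma normsq1_mulJ z : normsq z = 1 -> z * z^* = 1.
Proof.
move=> z1; apply: complexP; rewrite !cpxE; last by rewrite Im1; ring.
by rewrite Re1 -z1 /normsq; ring.
Qed.

Lemma conjD z w : (z + w)^* = z^* + w^*. Proof. exact: rmorphD. Qed.
Lemma conjM z w : (z * w)^* = z^* * w^*. Proof. exact: rmorphM. Qed.

(** The arithmetic-geometric mean inequality. Being pointwise, it integrates
    to a bound of inner products, from which the operator bounds below follow
    by a choice of the weight M. *)
Lemma Re_mulJ_le (M : R) z w : 0 < M ->
  2 * Re (z * w^*) <= M * normsq z + M^-1 * normsq w.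
Proof.
move=> M0; rewrite !cpxE /normsq -subr_ge0.
have -> : M * (Re z ^+ 2 + Im z ^+ 2) + M^-1 * (Re w ^+ 2 + Im w ^+ 2) -
   2 * (Re z * Re w - Im z * - Im w) =
   M^-1 * ((M * Re z - Re w) ^+ 2 + (M * Im z - Im w) ^+ 2).
  by field; rewrite gt_eqF.
by rewrite mulr_ge0 ?invr_ge0 ?(ltW M0)// addr_ge0// sqr_ge0.
Qed.
End complex_numbers.

(** * Complex-valued integrable and square integrable functions *)

Section complex_integral.
Context d (T : measurableType d) (R : realType).
Variable mu : {measure set T -> \bar R}.
Implicit Types f h : T -> R[i].

(** The squared L^2 norm. *)
Definition energy f : \bar R := (\int[mu]_x (normsq (f x))%:E)%E.

Definition cintegrable f : Prop :=
  mu.-integrable setT (fun x => (Re (f x))%:E) /\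
  mu.-integrable setT (fun x => (Im (f x))%:E).

Lemma energy_ge0 f : (0 <= energy f)%E.
Proof. by apply: integral_ge0 => x _; rewrite lee_fin normsq_ge0. Qed.

Lemma measurable_normsq f : cmeasurable f ->
  measurable_fun setT (fun x => normsq (f x)).
Proof.
by move=> [mr mi]; apply: measurable_funD; exact: measurable_funX.
Qed.

Lemma measurable_normc f : cmeasurable f ->
  measurable_fun setT (fun x => ComplexField.Normc.normc (f x)).
Proof.
move=> mf; rewrite (_ : (fun _ => _) = (@powR R ^~ 2^-1) \o (fun x => normsq (f x))).
  exact: (measurableT_comp (measurable_powR _) (measurable_normsq mf)).
by apply/funext => x; rewrite normcE /= powR12_sqrt// normsq_ge0.
Qed.

Lemma cLnorm2_sq f : (cLnorm mu 2%:E f `^ 2 = energy f)%E.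
Proof.
rewrite /cLnorm poweR_Lnorm ?pnatr_eq0//; apply: eq_integral => x _.
rewrite abse_EFin ger0_norm; last by rewrite normcE sqrtr_ge0.
by rewrite poweR_EFin powR_mulrn ?normcE ?sqrtr_ge0// sqr_sqrtr ?normsq_ge0.
Qed.

Lemma memL2P f : memL mu 2%:E f <-> cmeasurable f /\ (energy f < +oo)%E.
Proof.
rewrite /memL -cLnorm2_sq; split=> -[mf fy]; split=> //; first exact: poweR_lty.
apply: contraTT fy; rewrite -!leNgt !leye_eq => /eqP ->.
by rewrite poweRyr// pnatr_eq0.
Qed.

Lemma memL2_integrable f : memL mu 2%:E f ->
  mu.-integrable setT (fun x => (normsq (f x))%:E).
Proof.
move=> /memL2P[mf fy]; apply/integrableP; split.
  exact/measurable_EFinP/measurable_normsq.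
rewrite (eq_integral (fun x => (normsq (f x))%:E))// => x _.
by rewrite /= ger0_norm// normsq_ge0.
Qed.

Lemma memL2_fin_num f : memL mu 2%:E f -> energy f \is a fin_num.
Proof. by move=> /memL2P[_ fy]; rewrite ge0_fin_numE// energy_ge0. Qed.

Lemma cintegrableW f (b : T -> R) : cmeasurable f ->
  mu.-integrable setT (EFin \o b) ->
  (forall x, `|Re (f x)| <= b x /\ `|Im (f x)| <= b x) -> cintegrable f.
Proof.
move=> [mr mi] ib fb; split; apply: le_integrable ib => //=;
  try exact/measurable_EFinP; move=> x _; rewrite lee_fin.
- by rewrite (le_trans (fb x).1)// ler_norm.
- by rewrite (le_trans (fb x).2)// ler_norm.
Qed.

Lemma memL1P f : memL mu 1%:E f <-> cintegrable f.
Proof.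
rewrite /memL /cLnorm Lnorm1.
under eq_integral => x _.
  rewrite abse_EFin ger0_norm; last by rewrite normcE sqrtr_ge0.
  over.
split=> [[mf fy]|[/integrableP[mr ir] /integrableP[mi ii]]].
  apply: (@cintegrableW _ (fun x => ComplexField.Normc.normc (f x))) => //.
    apply/integrableP; split=> /=.
      exact/measurable_EFinP/measurable_normc.
    rewrite (eq_integral (fun x => (ComplexField.Normc.normc (f x))%:E))// => x _.
    by rewrite /= ger0_norm// normcE sqrtr_ge0.
  move=> x; rewrite normcE -!sqrtr_sqr.
  by split; rewrite ler_wsqrtr// /normsq ?lerDl ?lerDr sqr_ge0.
have mf : cmeasurable f by split; exact/measurable_EFinP.
split=> //.
apply: (@le_lt_trans _ _ (\int[mu]_x (`|(Re (f x))%:E| + `|(Im (f x))%:E|))%E).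
  apply: ge0_le_integral => //.
  - by move=> x _; rewrite lee_fin normcE sqrtr_ge0.
  - exact/measurable_EFinP/measurable_normc.
  - by apply: emeasurable_funD; exact: measurableT_comp.
  - move=> x _; rewrite /= -EFinD lee_fin normcE /normsq.
    rewrite -[leRHS]ger0_norm ?addr_ge0// -sqrtr_sqr ler_wsqrtr//.
    rewrite sqrrD !real_normK ?num_real// lerD2r lerDl.
    by rewrite mulrn_wge0// mulr_ge0.
rewrite ge0_integralD//; try exact: measurableT_comp.
exact: lte_add_pinfty.
Qed.

Lemma cintegrableD f h : cintegrable f -> cintegrable h ->
  cintegrable (fun x => f x + h x).
Proof.
move=> [fr fi] [hr hi]; split.
- by under eq_fun do rewrite ReD EFinD; exact: integrableD.
- by under eq_fun do rewrite ImD EFinD; exact: integrableD.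
Qed.

Lemma cintegrable0 : cintegrable (fun=> 0 : R[i]).
Proof. by split; exact: integrable0. Qed.

Lemma cintegrable_sum (I : Type) (r : seq I) (F : I -> T -> R[i]) :
  (forall i, cintegrable (F i)) -> cintegrable (fun x => \sum_(i <- r) F i x).
Proof.
move=> iF; elim: r => [|i r ih].
  by under eq_fun do rewrite big_nil; exact: cintegrable0.
by under eq_fun do rewrite big_cons; exact: cintegrableD.
Qed.

Lemma integrableZl_EFin k (b : T -> R) : mu.-integrable setT (fun x => (b x)%:E) ->
  mu.-integrable setT (fun x => (k * b x)%:E).
Proof.
by move=> bi; under eq_fun do rewrite EFinM; exact: integrableZl.
Qed.

Lemma Re_cintegral f : Re (cintegral mu f) = \int[mu]_x Re (f x).
Proof. by []. Qed.
Lemma Im_cintegral f : Im (cintegral mu f) = \int[mu]_x Im (f x).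
Proof. by []. Qed.

Lemma cintegralD f h : cintegrable f -> cintegrable h ->
  cintegral mu (fun x => f x + h x) = cintegral mu f + cintegral mu h.
Proof.
move=> [fr fi] [hr hi]; apply: complexP; rewrite ?cpxE !(Re_cintegral, Im_cintegral).
- by under eq_Rintegral do rewrite ReD; rewrite RintegralD.
- by under eq_Rintegral do rewrite ImD; rewrite RintegralD.
Qed.

Lemma cintegralZ c f : cintegrable f ->
  cintegral mu (fun x => c * f x) = c * cintegral mu f.
Proof.
move=> [fr fi]; apply: complexP; rewrite ?cpxE !(Re_cintegral, Im_cintegral).
- under eq_Rintegral do rewrite ReM.
  by rewrite RintegralB ?RintegralZl//; exact: integrableZl_EFin.
- under eq_Rintegral do rewrite ImM.
  by rewrite RintegralD ?RintegralZl//; exact: integrableZl_EFin.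
Qed.

Lemma cintegralJ f : cintegrable f ->
  cintegral mu (fun x => (f x)^*) = (cintegral mu f)^*.
Proof.
move=> [fr fi]; apply: complexP; rewrite ?cpxE !(Re_cintegral, Im_cintegral).
- by under eq_Rintegral do rewrite ReJ.
- rewrite -mulN1r -RintegralZl//; apply: eq_Rintegral => x _.
  by rewrite ImJ mulN1r.
Qed.

Lemma cintegral0 : cintegral mu (fun=> 0) = 0.
Proof. by apply: complexP; rewrite ?Re_cintegral ?Im_cintegral /Rintegral integral0. Qed.

Lemma cintegral_sum (I : Type) (r : seq I) (F : I -> T -> R[i]) :
  (forall i, cintegrable (F i)) ->
  cintegral mu (fun x => \sum_(i <- r) F i x) = \sum_(i <- r) cintegral mu (F i).
Proof.
move=> iF; elim: r => [|i r ih].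
  by under eq_fun do rewrite big_nil; rewrite big_nil cintegral0.
under eq_fun do rewrite big_cons.
by rewrite big_cons cintegralD ?ih//; exact: cintegrable_sum.
Qed.

Lemma eq_cintegral f h : f =1 h -> cintegral mu f = cintegral mu h.
Proof. by move=> /funext ->. Qed.

Lemma cmeasurableD f h : cmeasurable f -> cmeasurable h ->
  cmeasurable (fun x => f x + h x).
Proof.
move=> [fr fi] [hr hi]; split.
- by under eq_fun do rewrite ReD; exact: measurable_funD.
- by under eq_fun do rewrite ImD; exact: measurable_funD.
Qed.

Lemma cmeasurableM f h : cmeasurable f -> cmeasurable h ->
  cmeasurable (fun x => f x * h x).
Proof.
move=> [fr fi] [hr hi]; split.
- by under eq_fun do rewrite ReM; apply: measurable_funB; exact: measurable_funM.
- by under eq_fun do rewrite ImM; apply: measurable_funD; exact: measurable_funM.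
Qed.

Lemma cmeasurableJ f : cmeasurable f -> cmeasurable (fun x => (f x)^*).
Proof.
move=> [fr fi]; split.
- by under eq_fun do rewrite ReJ.
- by under eq_fun do rewrite ImJ; exact: measurable_funN.
Qed.

Lemma cmeasurable_cst (c : R[i]) : cmeasurable (fun _ : T => c).
Proof. by split; exact: measurable_cst. Qed.

Lemma memL2D f h : memL mu 2%:E f -> memL mu 2%:E h ->
  memL mu 2%:E (fun x => f x + h x).
Proof.
move=> /[dup] /memL2P[mf fy] fL /[dup] /memL2P[mh hy] hL; apply/memL2P.
split; first exact: cmeasurableD.
apply: (@le_lt_trans _ _
    (\int[mu]_x (2%:E * (normsq (f x))%:E + 2%:E * (normsq (h x))%:E))%E).
  apply: ge0_le_integral => //.
  - by move=> x _; rewrite lee_fin normsq_ge0.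
  - exact/measurable_EFinP/measurable_normsq/cmeasurableD.
  - by apply: emeasurable_funD; apply: measurable_funeM;
      exact/measurable_EFinP/measurable_normsq.
  - move=> x _; rewrite -!EFinM -EFinD lee_fin /normsq !cpxE -subr_ge0.
    set a := Re (f x); set b := Im (f x); set a' := Re (h x); set b' := Im (h x).
    have -> : 2 * (a ^+ 2 + b ^+ 2) + 2 * (a' ^+ 2 + b' ^+ 2) -
       ((a + a') ^+ 2 + (b + b') ^+ 2) = (a - a') ^+ 2 + (b - b') ^+ 2 by ring.
    by rewrite addr_ge0// sqr_ge0.
rewrite ge0_integralD//=; last 4 first.
- by move=> x _; rewrite mule_ge0// lee_fin ?normsq_ge0.
- by apply: measurable_funeM; exact/measurable_EFinP/measurable_normsq.
- by move=> x _; rewrite mule_ge0// lee_fin ?normsq_ge0.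
- by apply: measurable_funeM; exact/measurable_EFinP/measurable_normsq.
rewrite !ge0_integralZl_EFin//;
  try (by move=> x _; rewrite lee_fin normsq_ge0);
  try exact/measurable_EFinP/measurable_normsq.
by apply: lte_add_pinfty; apply: lte_mul_pinfty.
Qed.

Lemma memL2Z c f : memL mu 2%:E f -> memL mu 2%:E (fun x => c * f x).
Proof.
move=> /memL2P[mf fy]; apply/memL2P; split.
  by apply: cmeasurableM => //; exact: cmeasurable_cst.
rewrite /energy; under eq_integral do rewrite normsqM EFinM.
rewrite ge0_integralZl_EFin ?normsq_ge0//.
- by apply: lte_mul_pinfty => //; rewrite lee_fin normsq_ge0.
- by move=> x _; rewrite lee_fin normsq_ge0.
- exact/measurable_EFinP/measurable_normsq.
Qed.

Lemma energy0 : energy (fun=> 0 : R[i]) = 0%E.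
Proof. by rewrite /energy; under eq_integral do rewrite normsq0; rewrite integral0. Qed.

Lemma memL20 : memL mu 2%:E (fun=> 0 : R[i]).
Proof. by apply/memL2P; rewrite energy0; split=> //; exact: cmeasurable_cst. Qed.

Lemma cintegrable_mulJ f h : memL mu 2%:E f -> memL mu 2%:E h ->
  cintegrable (fun x => f x * (h x)^*).
Proof.
move=> fL hL; apply: (@cintegrableW _ (fun x => normsq (f x) + normsq (h x))).
- by apply: cmeasurableM; [case: fL|apply: cmeasurableJ; case: hL].
- rewrite /comp; under eq_fun do rewrite EFinD.
  by apply: integrableD => //; exact: memL2_integrable.
- move=> x; have e z w : 2 * `|Re (z * w^*)| <= normsq z + normsq w :> R.
    have [_|_] := ger0P (Re (z * w^*)).
      by have := @Re_mulJ_le R 1 z w ltr01; rewrite invr1 !mul1r.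
    have := @Re_mulJ_le R 1 z (- w) ltr01; rewrite invr1 !mul1r /normsq !cpxE.
    by rewrite !sqrrN; lra.
  have n0 := normsq_ge0 (f x); have n1 := normsq_ge0 (h x).
  split; first by have := e (f x) (h x); lra.
  (* the imaginary part of z conj(w) is the real part of z conj('i w) *)
  have := e (f x) ('i * h x); rewrite normsqM.
  have -> : normsq ('i : R[i]) = 1 by rewrite /normsq /= expr0n expr1n add0r.
  rewrite mul1r (_ : Re _ = Im (f x * (h x)^*)) => [|]; last first.
    by rewrite !cpxE /=; ring.
  by lra.
Qed.

Lemma innerDl f1 f2 h : memL mu 2%:E f1 -> memL mu 2%:E f2 -> memL mu 2%:E h ->
  inner mu (fun x => f1 x + f2 x) h = inner mu f1 h + inner mu f2 h.
Proof.
move=> f1L f2L hL; rewrite /inner -cintegralD; try exact: cintegrable_mulJ.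
by apply: eq_cintegral => x; rewrite mulrDl.
Qed.

Lemma innerZl c f h : memL mu 2%:E f -> memL mu 2%:E h ->
  inner mu (fun x => c * f x) h = c * inner mu f h.
Proof.
move=> fL hL; rewrite /inner -cintegralZ; last exact: cintegrable_mulJ.
by apply: eq_cintegral => x; rewrite mulrA.
Qed.

Lemma innerJ f h : memL mu 2%:E f -> memL mu 2%:E h ->
  inner mu h f = (inner mu f h)^*.
Proof.
move=> fL hL; rewrite /inner -cintegralJ; last exact: cintegrable_mulJ.
by apply: eq_cintegral => x; rewrite conjM conjCK mulrC.
Qed.

Lemma innerZr c f h : memL mu 2%:E f -> memL mu 2%:E h ->
  inner mu h (fun x => c * f x) = c^* * inner mu h f.
Proof.
move=> fL hL; rewrite (innerJ (memL2Z c fL) hL) innerZl// conjM.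
by rewrite -(innerJ fL hL).
Qed.

Lemma innerDr f1 f2 h : memL mu 2%:E f1 -> memL mu 2%:E f2 -> memL mu 2%:E h ->
  inner mu h (fun x => f1 x + f2 x) = inner mu h f1 + inner mu h f2.
Proof.
move=> f1L f2L hL; rewrite (innerJ (memL2D f1L f2L) hL) innerDl// conjD.
by rewrite -(innerJ f1L hL) -(innerJ f2L hL).
Qed.

Lemma inner0l h : inner mu (fun=> 0) h = 0.
Proof. by rewrite /inner; under eq_cintegral do rewrite mul0r; exact: cintegral0. Qed.

Lemma inner_self f : inner mu f f = (fine (energy f))%:C.
Proof.
apply: complexP; rewrite ?Im_real ?Re_cintegral ?Im_cintegral /=.
- by congr fine; apply: eq_integral => x _; rewrite cpxE !cpxE mulrN opprK -!expr2.
- rewrite (@eq_Rintegral _ _ _ _ _ (fun=> 0)) => [|x _].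
    by rewrite /Rintegral integral0.
  by rewrite !cpxE; ring.
Qed.

Lemma energyD f h : memL mu 2%:E f -> memL mu 2%:E h ->
  fine (energy (fun x => f x + h x)) =
  fine (energy f) + fine (energy h) + 2 * Re (inner mu f h).
Proof.
move=> fL hL; have fhL := memL2D fL hL.
have E u : fine (energy u) = Re (inner mu u u) by rewrite inner_self.
rewrite !E innerDl// !innerDr// (innerJ fL hL) !cpxE; ring.
Qed.

Lemma Re_inner_le (M : R) f h : 0 < M -> memL mu 2%:E f -> memL mu 2%:E h ->
  2 * Re (inner mu f h) <= M * fine (energy f) + M^-1 * fine (energy h).
Proof.
move=> M0 fL hL; have [fhr _] := cintegrable_mulJ fL hL.
have fi := memL2_integrable fL; have hi := memL2_integrable hL.
rewrite Re_cintegral -RintegralZl// -[fine (energy f)]/(Rintegral mu setT _).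
rewrite -[fine (energy h)]/(Rintegral mu setT _) -!RintegralZl//=.
rewrite -RintegralD//=; try exact: integrableZl_EFin.
apply: le_Rintegral => //=; first exact: integrableZl_EFin.
  rewrite /comp; under eq_fun do rewrite EFinD.
  by apply: integrableD => //; exact: integrableZl_EFin.
by move=> x _; exact: Re_mulJ_le.
Qed.
End complex_integral.

(** * Matrices of square integrable functions *)

Section matrices_over_L2.
Context d (T : measurableType d) (R : realType).
Variable mu : {measure set T -> \bar R}.
Variables n m : nat.
Implicit Types a b c : 'M[T -> R[i]]_(n, m).

Definition mxenergy a : R := \sum_i \sum_j fine (energy mu (a i j)).

Lemma mxenergy_ge0 a : 0 <= mxenergy a.
Proof. by do 2!apply: sumr_ge0 => ? _; rewrite fine_ge0 ?energy_ge0. Qed.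

Lemma le_mxenergy a i j : fine (energy mu (a i j)) <= mxenergy a.
Proof.
have e0 k l : 0 <= fine (energy mu (a k l)) by rewrite fine_ge0 ?energy_ge0.
rewrite /mxenergy (bigD1 i)//= (bigD1 j)//= -addrA lerDl addr_ge0//.
  by apply: sumr_ge0.
by do 2!apply: sumr_ge0 => ? _.
Qed.

Lemma mxinner_self a : mxinner mu a a = (mxenergy a)%:C.
Proof.
rewrite /mxinner /mxenergy raddf_sum; apply: eq_bigr => i _.
by rewrite raddf_sum; apply: eq_bigr => j _; exact: inner_self.
Qed.

Lemma mxinner_lincomb k a b c : mxmemL2 mu a -> mxmemL2 mu b -> mxmemL2 mu c ->
  mxinner mu (mxlincomb k a b) c = k * mxinner mu a c + mxinner mu b c.
Proof.
move=> aL bL cL; rewrite mulr_sumr -big_split; apply: eq_bigr => i _ /=.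
rewrite mulr_sumr -big_split; apply: eq_bigr => j _ /=.
by rewrite mxE innerDl ?innerZl//; exact: memL2Z.
Qed.

Lemma mxmemL2_lincomb k a b : mxmemL2 mu a -> mxmemL2 mu b ->
  mxmemL2 mu (mxlincomb k a b).
Proof. by move=> aL bL i j; rewrite mxE; apply: memL2D => //; exact: memL2Z. Qed.

Lemma mxinnerJ a b : mxmemL2 mu a -> mxmemL2 mu b ->
  mxinner mu b a = (mxinner mu a b)^*.
Proof.
move=> aL bL; rewrite rmorph_sum; apply: eq_bigr => i _.
by rewrite rmorph_sum; apply: eq_bigr => j _; exact: innerJ.
Qed.

Lemma mxinner0l a b : (forall i j, a i j = fun=> 0) -> mxinner mu a b = 0.
Proof.
by move=> a0; rewrite /mxinner big1// => i _; rewrite big1// => j _;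
  rewrite a0 inner0l.
Qed.

Lemma Re_mxinner_le (M : R) a b : 0 < M -> mxmemL2 mu a -> mxmemL2 mu b ->
  2 * Re (mxinner mu a b) <= M * mxenergy a + M^-1 * mxenergy b.
Proof.
move=> M0 aL bL; rewrite Re_sum !mulr_sumr -big_split; apply: ler_sum => i _ /=.
rewrite Re_sum !mulr_sumr -big_split; apply: ler_sum => j _ /=.
exact: Re_inner_le.
Qed.

Lemma mxL2normE a : mxmemL2 mu a ->
  mxL2norm mu a = ((mxenergy a)%:E `^ 2^-1)%E.
Proof.
move=> aL; congr (poweR _ _); rewrite -sumEFin; apply: eq_bigr => i _.
rewrite -sumEFin; apply: eq_bigr => j _.
by rewrite cLnorm2_sq fineK// memL2_fin_num.
Qed.

Lemma mxenergy_le (K : R) a b : 0 < K -> mxmemL2 mu a -> mxmemL2 mu b ->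
  (mxL2norm mu a <= K%:E * mxL2norm mu b)%E -> mxenergy a <= K ^+ 2 * mxenergy b.
Proof.
move=> K0 aL bL; rewrite !mxL2normE// !poweR_EFin -EFinM lee_fin.
rewrite !powR12_sqrt ?mxenergy_ge0// => ab.
rewrite -[leLHS]sqr_sqrtr ?mxenergy_ge0// -[mxenergy b]sqr_sqrtr ?mxenergy_ge0//.
by rewrite -exprMn lerXn2r// nnegrE ?mulr_ge0 ?sqrtr_ge0// ltW.
Qed.
End matrices_over_L2.

(** * Square summable functions on a discrete space *)

Section counting_measure.
Context d (T : measurableType d) (R : realType).
Hypothesis discrete : forall A : set T, measurable A.
Local Notation mu := (@counting T R).
Implicit Types u v : T -> R[i].

Lemma discrete_measurable_fun d' (T' : measurableType d') (f : T -> T') D :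
  measurable_fun D f.
Proof. by move=> _ Y _; exact: discrete. Qed.

Lemma discrete_cmeasurable u : cmeasurable u.
Proof. by split; exact: discrete_measurable_fun. Qed.

Definition dirac_fun (z : T) : T -> R[i] := fun x => (x == z)%:R.

Lemma counting1 (z : T) : mu [set z] = 1%E.
Proof. by rewrite /counting asboolT// fset_set1 cardfs1. Qed.

Lemma integral_dirac_fun (z : T) : (\int[mu]_x ((x == z)%:R : R)%:E)%E = 1%E.
Proof.
rewrite (eq_integral (fun x => (\1_[set z] x)%:E)) => [|x _].
  by rewrite integral_indic// setIT; exact: counting1.
rewrite indicE; congr ((nat_of_bool _)%:R)%:E.
by apply/idP/idP => [/eqP ->|/set_mem /= ->]; [exact: mem_set|exact: eqxx].
Qed.

Lemma dirac_fun_memL2 z : memL mu 2%:E (dirac_fun z).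
Proof.
apply/memL2P; split; first exact: discrete_cmeasurable.
rewrite /energy (eq_integral (fun x => ((x == z)%:R : R)%:E)) => [|x _].
  by rewrite integral_dirac_fun ltry.
rewrite /dirac_fun; case: eqP => _; last by rewrite normsq0.
by rewrite /normsq /= expr1n expr0n addr0.
Qed.

Lemma inner_dirac_fun u z : inner mu u (dirac_fun z) = u z.
Proof.
rewrite /inner (@eq_cintegral _ _ _ _ _ (fun x => u z * dirac_fun z x)); last first.
  move=> x; rewrite /dirac_fun; case: eqP => [->|_].
    by rewrite rmorph1.
  by rewrite rmorph0 !mulr0.
have Ei : mu.-integrable setT (fun x : T => ((x == z)%:R : R)%:E).
  apply/integrableP; split; first exact: discrete_measurable_fun.
  rewrite (eq_integral (fun x => ((x == z)%:R : R)%:E)) ?integral_dirac_fun ?ltry//.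
  by move=> x _; case: eqP; rewrite abse_EFin ?normr1 ?normr0.
have ReE x : Re (dirac_fun z x) = (x == z)%:R.
  by rewrite /dirac_fun; case: eqP.
have ImE x : Im (dirac_fun z x) = 0.
  by rewrite /dirac_fun; case: eqP.
rewrite cintegralZ; last first.
  split; first by under eq_fun do rewrite ReE.
  by under eq_fun do rewrite ImE; exact: integrable0.
rewrite (_ : cintegral _ _ = 1) ?mulr1//; apply: complexP.
  rewrite Re_cintegral /Rintegral; under eq_integral do rewrite ReE.
  by rewrite integral_dirac_fun.
rewrite Im_cintegral /Rintegral; under eq_integral do rewrite ImE.
by rewrite integral0.
Qed.

Definition truncation (s : seq T) u : T -> R[i] :=
  fun x => if x \in s then u x else 0.

Lemma truncation_memL2 s u : memL mu 2%:E (truncation s u).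
Proof.
suff -> : truncation s u = (fun x => \sum_(z <- undup s) u z * dirac_fun z x).
  elim: (undup s) => [|z t ih].
    by under eq_fun do rewrite big_nil; exact: memL20.
  under eq_fun do rewrite big_cons.
  by apply: memL2D => //; apply: memL2Z; exact: dirac_fun_memL2.
apply/funext => x; rewrite /truncation -mem_undup; case: ifPn => xs.
  rewrite (bigD1_seq x)//= ?undup_uniq// /dirac_fun eqxx mulr1 big1 ?addr0// => z.
  by rewrite eq_sym => /negbTE ->; rewrite mulr0.
rewrite big_seq big1// => z zs; rewrite /dirac_fun.
by case: eqP xs => [->|_ _]; rewrite ?zs ?mulr0.
Qed.

(** The set where |u|^2 is at least 1/(k+1) has at most (k+1)M points, because
    its finite subsets do. These finite sets increase to the support of u, and
    monotone convergence concludes. *)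
Lemma energy_le_truncations u (M : R) :
  (forall s, energy mu (truncation s u) <= M%:E)%E -> (energy mu u <= M%:E)%E.
Proof.
move=> uM; pose A k := [set x | k.+1%:R^-1 <= normsq (u x)].
have fA k : finite_set (A k).
  apply: contrapT => /(@infinite_set_fset _ _ (Num.truncn (k.+1%:R * M)).+1)[B BA].
  move=> cB; have := uM (enum_fset B); rewrite leNgt => /negP; apply.
  apply: (@lt_le_trans _ _ (\int[mu]_(x in [set` B]) (k.+1%:R^-1)%:E)%E).
    rewrite integral_cst//= -lte_pdivrMl ?invr_gt0// invrK -EFinM.
    rewrite /counting asboolT ?set_fsetK// lte_fin.
    by apply: lt_le_trans (truncnS_gt _) _; rewrite ler_nat.
  rewrite integral_mkcond; apply: ge0_le_integral => //;
    try exact: discrete_measurable_fun.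
  - by move=> x _; rewrite patchE; case: ifP => // _; rewrite lee_fin.
  - move=> x _; rewrite patchE; case: ifPn => [/set_mem /= xB|_]; last first.
      by rewrite lee_fin normsq_ge0.
    rewrite lee_fin /truncation ifT//.
    exact: BA.
have nA : nondecreasing_seq A.
  move=> k l kl; apply/subsetPset => x /=; apply: le_trans.
  by rewrite lef_pV2 ?posrE// ler_nat.
rewrite /energy (_ : (\int[mu]_x _)%E =
    (\int[mu]_(x in \bigcup_k A k) (normsq (u x))%:E)%E); last first.
  rewrite [RHS]integral_mkcond; apply: eq_integral => x _.
  rewrite patchE; case: ifPn => // /negP nx; congr EFin; apply/eqP.
  rewrite eq_le normsq_ge0 andbT leNgt; apply/negP => u0; apply: nx.
  apply/mem_set; exists (Num.truncn (normsq (u x))^-1) => //=; rewrite /A /=.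
  rewrite -[leRHS]invrK lef_pV2 ?posrE ?invr_gt0//.
  exact/ltW/truncnS_gt.
have cvgA : (\int[mu]_(x in A k) (normsq (u x))%:E @[k --> \oo] -->
    \int[mu]_(x in \bigcup_k A k) (normsq (u x))%:E)%E.
  apply: ge0_nondecreasing_set_cvg_integral => //.
  - by move=> k; exact: discrete_measurable_fun.
  - by move=> k x _; rewrite lee_fin normsq_ge0.
rewrite -(cvg_lim _ cvgA)//; apply: lime_le; first by apply/cvg_ex; eexists; exact: cvgA.
apply: nearW => k; apply: le_trans (uM (enum_fset (fset_set (A k)))).
rewrite integral_mkcond; apply: ge0_le_integral => //;
  try exact: discrete_measurable_fun.
- by move=> x _; rewrite patchE; case: ifP => // _; rewrite lee_fin normsq_ge0.
- move=> x _; rewrite patchE; case: ifPn => [|_]; last first.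
    by rewrite lee_fin normsq_ge0.
  by move=> xA; rewrite /truncation ifT// in_fset_set.
Qed.
End counting_measure.

(** * Borel sets, translations and time-frequency shifts *)

Section borel_sets.
Variables (R : realType) (G : PreTopologicalZmodule.type).

Lemma open_borel (U : set G) : open U -> measurable (U : set (borel G)).
Proof. by move=> oU; apply: (@sub_sigma_algebra G setT (@open G) U). Qed.

Lemma closed_borel (U : set G) : closed U -> measurable (U : set (borel G)).
Proof.
move=> cU; rewrite -[U]setCK; apply: (@measurableC _ (borel G)).
by apply: open_borel; exact: closed_openC.
Qed.

Lemma continuous_borel (f : G -> G) : continuous f ->
  measurable_fun setT (f : borel G -> borel G).
Proof.
move=> cf; apply: (@measurability _ _ (borel G) (borel G) setT f (@open G)) => //.
move=> _ [U oU <-]; rewrite setTI; apply: open_borel.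
by apply: open_comp => // x _; exact: cf.
Qed.

Lemma continuous_Re (f : G -> R[i]) :
  continuous (f : G -> R[i]^o) -> continuous (fun x => Re (f x)).
Proof.
move=> cf t; have /cvgrPdist_lt fz := cf t; apply/cvgrPdist_lt => e e0.
have /= := fz e%:C; rewrite ltcR => /(_ e0); apply: filterS => x.
rewrite normc_def ltcR; apply: le_lt_trans.
by rewrite -[leLHS]sqrtr_sqr ler_wsqrtr// ReD ReN lerDl sqr_ge0.
Qed.

Lemma continuous_Im (f : G -> R[i]) :
  continuous (f : G -> R[i]^o) -> continuous (fun x => Im (f x)).
Proof.
move=> cf t; have /cvgrPdist_lt fz := cf t; apply/cvgrPdist_lt => e e0.
have /= := fz e%:C; rewrite ltcR => /(_ e0); apply: filterS => x.
rewrite normc_def ltcR; apply: le_lt_trans.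
by rewrite -[leLHS]sqrtr_sqr ler_wsqrtr// ImD ImN lerDr sqr_ge0.
Qed.

Lemma continuous_measurable_borel (f : G -> R) : continuous f ->
  measurable_fun setT (f : borel G -> R).
Proof.
move=> cf; apply: (measurability _ (RGenOInfty.measurableE R)) => //.
move=> _ [_ [a ->] <-]; rewrite setTI; apply: open_borel.
by apply: open_comp => [x _|]; [exact: cf|exact: interval_open].
Qed.

Lemma continuous_cmeasurable_borel (f : G -> R[i]) :
  continuous (f : G -> R[i]^o) -> cmeasurable (f : borel G -> R[i]).
Proof.
by move=> cf; split; apply: continuous_measurable_borel;
  [exact: continuous_Re|exact: continuous_Im].
Qed.
End borel_sets.

Section translations.
Variables (R : realType) (G : topologicalZmodType).
Variable mu : {measure set (borel G) -> \bar R}.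
Hypothesis mu_haar : haar_measure mu.

Lemma continuous_shift (x : G) : continuous (fun t : G => t - x).
Proof.
move=> t; apply: (@continuous_comp _ _ _ (fun t => (t, - x)) (fun z => z.1 + z.2)).
  by apply: cvg_pair; [exact: cvg_id|exact: cvg_cst].
exact: add_continuous.
Qed.

Lemma measurable_shift (x : G) :
  measurable_fun setT ((fun t => t - x) : borel G -> borel G).
Proof. by apply: continuous_borel; exact: continuous_shift. Qed.

Lemma ge0_integral_shift (x : G) (f : borel G -> \bar R) :
  measurable_fun setT f -> (forall t, 0 <= f t)%E ->
  (\int[mu]_t f (t - x)%R = \int[mu]_t f t)%E.
Proof.
move=> mf f0; have [_ inv _] := mu_haar.
have := @ge0_integral_pushforward _ _ _ _ R _ (measurable_shift x) mu setT f
  measurableT mf (fun t _ => f0 t).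
rewrite preimage_setT => <-.
apply: (eq_measure_integral mu); first exact: measurable_shift.
move=> mshift A mA _; rewrite /pushforward -(inv x A mA).
congr (mu _); apply/seteqP; split=> t /=.
  by exists (t - x) => //; rewrite addrC subrK.
by move=> [y Ay <-]; rewrite addrC addKr.
Qed.

Lemma integral_shift (x : G) (f : borel G -> R) : measurable_fun setT f ->
  (\int[mu]_t (f (t - x)%R)%:E = \int[mu]_t (f t)%:E)%E.
Proof.
move=> mf; have mf' : measurable_fun setT (EFin \o f) by exact/measurable_EFinP.
rewrite integralE [RHS]integralE; congr (_ - _)%E.
- rewrite -(ge0_integral_shift x (measurable_funepos mf') (fun t => funepos_ge0 _ t)).
  by apply: eq_integral => t _; rewrite !funeposE.
- rewrite -(ge0_integral_shift x (measurable_funeneg mf') (fun t => funeneg_ge0 _ t)).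
  by apply: eq_integral => t _; rewrite !funenegE.
Qed.

Lemma cintegral_shift (x : G) (f : borel G -> R[i]) : cmeasurable f ->
  cintegral mu (fun t => f (t - x)) = cintegral mu f.
Proof.
move=> [mr mi]; apply: complexP; rewrite ?Re_cintegral ?Im_cintegral /Rintegral.
- by rewrite (integral_shift x mr).
- by rewrite (integral_shift x mi).
Qed.

Implicit Types (f h : G -> R[i]) (xi eta : G * dual R G).

Lemma char_cmeasurable (w : dual R G) : cmeasurable (w : borel G -> R[i]).
Proof. by apply: continuous_cmeasurable_borel; exact: char_continuous. Qed.

Lemma char_normsq (w : dual R G) t : normsq (w t) = 1.
Proof. exact/normr1_normsq/char_norm. Qed.

Lemma cmeasurable_shift (x : G) f : cmeasurable (f : borel G -> R[i]) ->
  cmeasurable ((fun t => f (t - x)) : borel G -> R[i]).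
Proof.
move=> [mr mi]; split; [exact: (measurableT_comp mr (measurable_shift x))|].
exact: (measurableT_comp mi (measurable_shift x)).
Qed.

Lemma energy_tfshift xi f : cmeasurable (f : borel G -> R[i]) ->
  energy mu (tfshift xi f) = energy mu f.
Proof.
move=> mf; rewrite /energy -[RHS](integral_shift xi.1 (measurable_normsq mf)).
by apply: eq_integral => t _; rewrite normsqM char_normsq mul1r.
Qed.

Lemma memL2_tfshift xi f : memL mu 2%:E f -> memL mu 2%:E (tfshift xi f).
Proof.
move=> /memL2P[mf fy]; apply/memL2P; split; last by rewrite energy_tfshift.
by apply: cmeasurableM; [exact: char_cmeasurable|exact: cmeasurable_shift].
Qed.

Lemma inner_tfshift xi f h : memL mu 2%:E f -> memL mu 2%:E h ->
  inner mu (tfshift xi f) (tfshift xi h) = inner mu f h.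
Proof.
move=> [mf _] [mh _]; rewrite /inner -[RHS](cintegral_shift xi.1); last first.
  by apply: cmeasurableM => //; exact: cmeasurableJ.
apply: eq_cintegral => t; rewrite conjM mulrACA.
by rewrite (normsq1_mulJ (char_normsq _ _)) mul1r.
Qed.

(** The adjoint, hence the inverse, of the unitary operator [tfshift xi]. It is
    [tfshift (- xi)] up to a phase; this normalization has no phase in
    [tfshift_adjK]. *)
Definition tfshift_adj xi f : G -> R[i] :=
  fun t => (xi.2 (t + xi.1))^* * f (t + xi.1).

Lemma dualD (v w : dual R G) t : (v + w) t = v t * w t.
Proof. by []. Qed.

Lemma dualN (w : dual R G) t : (- w) t = (w t)^*.
Proof.
rewrite -[LHS]mul1r -(normsq1_mulJ (char_normsq w t)) mulrAC.
by rewrite [(- w) t]/((w t)^-1) divff ?char_neq0 ?mul1r.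
Qed.

Lemma tfshift_adjE xi f :
  tfshift_adj xi f = (fun t => (xi.2 xi.1)^* * tfshift (- xi) f t).
Proof.
apply/funext => t; rewrite /tfshift_adj /tfshift.
rewrite -[(- xi).2]/(- xi.2) -[(- xi).1]/(- xi.1) opprK dualN charD conjM; ring.
Qed.

Lemma tfshift_adjK xi f : tfshift xi (tfshift_adj xi f) = f.
Proof.
apply/funext => t; rewrite /tfshift_adj /tfshift subrK mulrA.
by rewrite (normsq1_mulJ (char_normsq _ _)) mul1r.
Qed.

Lemma memL2_tfshift_adj xi f :
  memL mu 2%:E f -> memL mu 2%:E (tfshift_adj xi f).
Proof. by move=> fL; rewrite tfshift_adjE; apply/memL2Z/memL2_tfshift. Qed.

Lemma energy_tfshift_adj xi f : memL mu 2%:E f ->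
  energy mu (tfshift_adj xi f) = energy mu f.
Proof.
move=> fL; rewrite -[in RHS](tfshift_adjK xi f) energy_tfshift//.
by case: (memL2_tfshift_adj xi fL).
Qed.

Lemma inner_tfshift_adj xi f h : memL mu 2%:E f -> memL mu 2%:E h ->
  inner mu (tfshift_adj xi f) h = inner mu f (tfshift xi h).
Proof.
move=> fL hL; rewrite -(@inner_tfshift xi) ?tfshift_adjK//.
exact: memL2_tfshift_adj.
Qed.

Lemma tfshiftD xi eta f : tfshift (xi + eta) f =
  (fun t => eta.2 xi.1 * tfshift xi (tfshift eta f) t).
Proof.
apply/funext => t; rewrite /tfshift.
rewrite -[(xi + eta).2]/(xi.2 + eta.2) -[(xi + eta).1]/(xi.1 + eta.1).
rewrite opprD addrA dualD.
by rewrite -[in eta.2 t](subrK xi.1 t) (charD eta.2 (t - xi.1) xi.1); ring.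
Qed.

Lemma inner_adj_tfshift xi eta f h : memL mu 2%:E f -> memL mu 2%:E h ->
  inner mu (tfshift_adj xi f) (tfshift eta h) =
  eta.2 xi.1 * inner mu f (tfshift (xi + eta) h).
Proof.
move=> fL hL; rewrite inner_tfshift_adj//; last exact: memL2_tfshift.
rewrite tfshiftD innerZr//; last by do 2!apply: memL2_tfshift.
by rewrite mulrA (normsq1_mulJ (char_normsq _ _)) mul1r.
Qed.

Lemma tfshiftK xi f : tfshift_adj xi (tfshift xi f) = f.
Proof.
apply/funext => t; rewrite /tfshift_adj /tfshift addrK mulrA.
by rewrite [X in X * _]mulrC (normsq1_mulJ (char_normsq _ _)) mul1r.
Qed.

Lemma inner_tfshiftD xi eta f h : memL mu 2%:E f -> memL mu 2%:E h ->
  inner mu (tfshift xi f) (tfshift (xi + eta) h) =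
  (eta.2 xi.1)^* * inner mu f (tfshift eta h).
Proof.
move=> fL hL; rewrite -[in RHS](tfshiftK xi f).
rewrite inner_adj_tfshift//; last exact: memL2_tfshift.
by rewrite mulrA [X in X * _]mulrC (normsq1_mulJ (char_normsq _ _)) mul1r.
Qed.

Lemma tfshift0 f : tfshift 0 f = f.
Proof. by apply/funext => t; rewrite /tfshift /= subr0 mul1r. Qed.
End translations.

(** * The biorthogonal dual of a Riesz sequence *)

Section lattice_expansions.
Variables (R : realType) (G : topologicalZmodType).
Variable mu : {measure set (borel G) -> \bar R}.
Variable L : zmodClosed (G * dual R G)%type.
Variables n d : nat.
Implicit Types (g h : 'M[G -> R[i]]_(n, d)) (psi : 'I_d -> G -> R[i]).

Definition lattice_coef g psi (l : 'I_n) (z : points L) : R[i] :=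
  \sum_m inner mu (psi m) (tfshift (val z) (g l m)).

(** The formal operator sum_(l, z) <., pi(z) g_l> pi(z) h_l of L^2(G)^d, given
    by its quadratic form, is positive and bounded by the identity. *)
Definition positive_contraction g h : Prop :=
  forall psi, (forall m, memL mu 2%:E (psi m)) ->
    [/\ forall l, memL counting 2%:E (lattice_coef g psi l),
        forall l, memL counting 2%:E (lattice_coef h psi l) &
        exists2 s : R, 0 <= s <= \sum_m fine (energy mu (psi m)) &
          \sum_l inner counting (lattice_coef g psi l) (lattice_coef h psi l)
            = s%:C].
End lattice_expansions.

Section riesz_sequences.
Variables (R : realType) (G : topologicalZmodType).
Variable mu : {sigma_finite_measure set (borel G) -> \bar R}.
Hypothesis mu_haar : haar_measure mu.
Variable L : zmodClosed (G * dual R G)%type.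
Variables (n d : nat) (g : 'M[G -> R[i]]_(n, d)).
Hypothesis gL2 : mxmemL2 mu g.
Local Notation cnt := (@counting (points L) R).
Local Notation C := (analysis mu L g).

Lemma points_discrete (A : set (points L)) : measurable A.
Proof. by []. Qed.

Lemma analysisE f k l z :
  C f k l z = \sum_m inner mu (f k m) (tfshift (val z) (g l m)).
Proof. by rewrite mxE. Qed.

Lemma analysis_lincomb c f h : mxmemL2 mu f -> mxmemL2 mu h ->
  C (mxlincomb c f h) = mxlincomb c (C f) (C h).
Proof.
move=> fL hL; apply/matrixP => k l; apply/funext => z.
rewrite [mxlincomb c (C f) (C h) k l]mxE !analysisE mulr_sumr -big_split.
apply: eq_bigr => m _ /=.
have gz := memL2_tfshift mu_haar (val z) (gL2 l m).
by rewrite mxE innerDl ?innerZl//; exact: memL2Z.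
Qed.

Section adjoint.
Variable D : 'M[points L -> R[i]]_(n, n) -> 'M[G -> R[i]]_(n, d).
Hypothesis D_adjoint : analysis_adjoint mu g D.
Hypothesis CD_iso : l2_isomorphism (C \o D).

Lemma CD_memL2 a : mxmemL2 cnt a -> mxmemL2 cnt (C (D a)).
Proof. by have [_ [CDl2 _ _] _] := CD_iso; exact: CDl2. Qed.

Lemma CD_surj b : mxmemL2 cnt b -> exists2 a, mxmemL2 cnt a & C (D a) = b.
Proof. by have [_ [_ _ CDs] _] := CD_iso; exact: CDs. Qed.

(** Since <D a, D a> = <C D a, a>, the bound K of C D yields
    |D a|^2 <= (K^2 + 1)/2 |a|^2. *)
Lemma adjoint_bounded : exists2 M : R, 0 < M &
  forall a, mxmemL2 cnt a -> mxenergy mu (D a) <= M * mxenergy cnt a.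
Proof.
have [_ _ [K K0 Kb]] := CD_iso.
exists ((K ^+ 2 + 1) / 2); first by rewrite divr_gt0// addr_gt0 ?exprn_gt0.
move=> a aL; have [DaL Dadj] := D_adjoint aL.
have CDaL := CD_memL2 aL; have /= [/(mxenergy_le K0 CDaL aL) le1 _] := Kb _ aL.
have := @Re_mxinner_le _ _ _ cnt _ _ 1 _ _ ltr01 CDaL aL.
rewrite Dadj// mxinner_self Re_real invr1 !mul1r; lra.
Qed.

(** The bound of C comes from that of D by duality. Testing the adjoint
    relation on the truncations a of C f to finite sets gives
    |a|^2 = <C f, a> = <f, D a>, which the bound of D turns into a bound of
    |a|^2 that is uniform in the finite set. *)
Lemma analysis_memL2 f : mxmemL2 mu f -> mxmemL2 cnt (C f).
Proof.
move=> fL; have [M M0 DM] := adjoint_bounded.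
pose a s : 'M[points L -> R[i]]_(n, n) := \matrix_(k, l) truncation s (C f k l).
have aL s : mxmemL2 cnt (a s).
  by move=> k l; rewrite mxE; apply: truncation_memL2; exact: points_discrete.
have aM s : mxenergy cnt (a s) <= M * mxenergy mu f.
  have [DaL Dadj] := D_adjoint (aL s); have := DM _ (aL s).
  have := Re_mxinner_le M0 fL DaL; rewrite -Dadj//.
  have -> : mxinner cnt (C f) (a s) = mxinner cnt (a s) (a s).
    apply: eq_bigr => k _; apply: eq_bigr => l _; apply: eq_cintegral => z.
    rewrite [a s k l]mxE /truncation; case: ifP => // _.
    by rewrite rmorph0 !mulr0.
  rewrite mxinner_self Re_real => le1 le2.
  have : M^-1 * mxenergy mu (D (a s)) <= mxenergy cnt (a s).
    by rewrite ler_pdivrMl.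
  lra.
move=> k l; apply/memL2P; split; first exact/discrete_cmeasurable/points_discrete.
apply: (@le_lt_trans _ _ (M * mxenergy mu f)%:E); last exact: ltry.
apply: energy_le_truncations => [|s]; first exact: points_discrete.
have skl : a s k l = truncation s (C f k l) by rewrite mxE.
rewrite -skl -(fineK (memL2_fin_num (aL s k l))) lee_fin.
exact: le_trans (le_mxenergy _ _ _ _) (aM s).
Qed.

Variable k0 : 'I_n.

(** The operator C acts on each row separately, so that a single row k0 carries
    all the information on the system generated by g. *)
Definition row_embed (psi : 'I_d -> G -> R[i]) : 'M[G -> R[i]]_(n, d) :=
  \matrix_(i, j) if i == k0 then psi j else (fun=> 0).

Definition dirac_mx (z : points L) (l : 'I_n) : 'M[points L -> R[i]]_(n, n) :=
  \matrix_(i, j) if (i == k0) && (j == l) then dirac_fun R z else (fun=> 0).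

Lemma row_embed_memL2 psi : (forall j, memL mu 2%:E (psi j)) ->
  mxmemL2 mu (row_embed psi).
Proof. by move=> pL i j; rewrite mxE; case: eqP => // _; exact: memL20. Qed.

Lemma dirac_mx_memL2 z l : mxmemL2 cnt (dirac_mx z l).
Proof.
move=> i j; rewrite mxE; case: ifP => _; last exact: memL20.
by apply: dirac_fun_memL2; exact: points_discrete.
Qed.

Lemma mxinner_row_embed psi f : (forall j, memL mu 2%:E (psi j)) ->
  mxinner mu (row_embed psi) f = \sum_j inner mu (psi j) (f k0 j).
Proof.
move=> pL; rewrite /mxinner (bigD1 k0)//= [X in _ + X]big1 ?addr0 => [|i /negbTE ik].
  by apply: eq_bigr => j _; rewrite mxE eqxx.
by rewrite big1// => j _; rewrite mxE ik inner0l.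
Qed.

Lemma mxenergy_row_embed psi : (forall j, memL mu 2%:E (psi j)) ->
  mxenergy mu (row_embed psi) = \sum_j fine (energy mu (psi j)).
Proof.
move=> pL; rewrite /mxenergy (bigD1 k0)//= [X in _ + X]big1 ?addr0 => [|i /negbTE ik].
  by apply: eq_bigr => j _; rewrite mxE eqxx.
by rewrite big1// => j _; rewrite mxE ik energy0.
Qed.

Lemma mxinner_dirac_mx (a : 'M[points L -> R[i]]_(n, n)) z l :
  mxinner cnt a (dirac_mx z l) = a k0 l z.
Proof.
have in0 (u : points L -> R[i]) : inner cnt u (fun=> 0) = 0.
  rewrite /inner (eq_cintegral _ (h := fun=> 0)) ?cintegral0// => x.
  by rewrite rmorph0 mulr0.
rewrite /mxinner (bigD1 k0)//= [X in _ + X]big1 ?addr0 => [|i /negbTE ik]; last first.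
  by rewrite big1// => j _; rewrite mxE ik in0.
rewrite (bigD1 l)//= [X in _ + X]big1 ?addr0 => [|j /negbTE jl]; last first.
  by rewrite mxE jl andbF in0.
by rewrite mxE !eqxx inner_dirac_fun//; exact: points_discrete.
Qed.

Definition mxshift xi (f : 'M[G -> R[i]]_(n, d)) : 'M[G -> R[i]]_(n, d) :=
  \matrix_(i, j) tfshift xi (f i j).
Definition mxshift_adj xi (f : 'M[G -> R[i]]_(n, d)) : 'M[G -> R[i]]_(n, d) :=
  \matrix_(i, j) tfshift_adj xi (f i j).

Lemma mxshift_memL2 xi f : mxmemL2 mu f -> mxmemL2 mu (mxshift xi f).
Proof. by move=> fL i j; rewrite mxE; exact: memL2_tfshift. Qed.

Lemma mxshift_adj_memL2 xi f : mxmemL2 mu f -> mxmemL2 mu (mxshift_adj xi f).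
Proof. by move=> fL i j; rewrite mxE; exact: memL2_tfshift_adj. Qed.

Lemma mxinner_shift_adj xi f h : mxmemL2 mu f -> mxmemL2 mu h ->
  mxinner mu (mxshift_adj xi f) h = mxinner mu f (mxshift xi h).
Proof.
move=> fL hL; apply: eq_bigr => i _; apply: eq_bigr => j _.
by rewrite !mxE inner_tfshift_adj.
Qed.

Lemma addr_points (z w : points L) : val z + val w \in L.
Proof. by rewrite rpredD ?(valP z) ?(valP w). Qed.
Lemma subr_points (z w : points L) : val z - val w \in L.
Proof. by rewrite rpredB ?(valP z) ?(valP w). Qed.

Lemma analysis_shift_adj (z w : points L) f k l : mxmemL2 mu f ->
  C (mxshift_adj (val z) f) k l w =
  (val w).2 (val z).1 * C f k l (exist (fun x => x \in L) _ (addr_points z w)).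
Proof.
move=> fL; rewrite !analysisE mulr_sumr; apply: eq_bigr => m _.
by rewrite mxE inner_adj_tfshift.
Qed.

Lemma analysis_shift (z w : points L) f k l : mxmemL2 mu f ->
  C (mxshift (val z) f) k l w = ((val w - val z).2 (val z).1)^* *
    C f k l (exist (fun x => x \in L) _ (subr_points w z)).
Proof.
move=> fL; rewrite !analysisE mulr_sumr; apply: eq_bigr => m _ /=.
have := inner_tfshiftD mu_haar (val z) (val w - val z) (fL k m) (gL2 l m).
rewrite mxE (_ : val z + (val w - val z) = val w) => [-> //|].
by rewrite addrC subrK.
Qed.

(** Covariance: C intertwines the time-frequency shift by a lattice point with
    the translation of the lattice up to phases, and the phase is 1 at the only
    point where the translated Dirac function does not vanish. *)
Lemma analysis_mxshift_dirac z l f : mxmemL2 mu f ->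
  C f = dirac_mx point l -> C (mxshift (val z) f) = dirac_mx z l.
Proof.
move=> fL Cf; apply/matrixP => i j; apply/funext => w.
rewrite analysis_shift// Cf !mxE; case: ifP => _; last by rewrite mulr0.
rewrite /dirac_fun -!val_eqE /= subr_eq0.
case: eqP => [->|_]; last by rewrite mulr0.
by rewrite divff ?char_neq0// rmorph1 mulr1.
Qed.

(** The dual window h_l is row k0 of D b_l, where C D b_l is the Dirac function
    at the origin in entry (k0, l). Given psi, let p = D c with C D c = C psi.
    Then r = psi - p and all its lattice shifts lie in the kernel of C,
    hence are orthogonal to the range of D. It follows that p is the orthogonal
    projection of psi, that c is the family of the <psi, pi(z) h_l>, and that
    <C psi, c> = <psi, p> = |p|^2. *)
Lemma dual_window : exists h : 'M[G -> R[i]]_(n, d),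
  [/\ mxmemL2 mu h,
      forall l, \sum_m inner mu (h l m) (g l m) = 1 &
      positive_contraction mu L g h].
Proof.
have ex l := CD_surj (dirac_mx_memL2 point l).
pose b l := s2val (cid2 (ex l)); pose q l := D (b l).
have bL l : mxmemL2 cnt (b l) by rewrite /b; case: cid2.
have Cq l : C (q l) = dirac_mx point l by rewrite /q /b; case: cid2.
have qL l : mxmemL2 mu (q l) by case: (D_adjoint (bL l)).
exists (\matrix_(l, m) q l k0 m); split=> [l m|l|psi psiL].
- by rewrite mxE; exact: qL.
- have <- : C (q l) k0 l point = 1 by rewrite Cq mxE !eqxx /= /dirac_fun eqxx.
  rewrite analysisE.
  by apply: eq_bigr => m _; rewrite mxE tfshift0.
pose f := row_embed psi.
have fL : mxmemL2 mu f by exact: row_embed_memL2.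
have CfL := analysis_memL2 fL.
have uE l : lattice_coef mu g psi l = C f k0 l.
  by apply/funext => z; rewrite analysisE; apply: eq_bigr => m _; rewrite mxE eqxx.
have Cf0 k l : k != k0 -> C f k l = (fun=> 0).
  move=> /negbTE kk0; apply/funext => z; rewrite analysisE big1// => m _.
  by rewrite mxE kk0 inner0l.
have [c cL CDc] := CD_surj CfL; pose p := D c.
have [pL padj] := D_adjoint cL.
pose r : 'M[G -> R[i]]_(n, d) := mxlincomb (T := borel G) (-1) p f.
have rL : mxmemL2 mu r by exact: mxmemL2_lincomb.
have Cr0 k l : C r k l = (fun=> 0).
  rewrite analysis_lincomb// CDc mxE; apply/funext => z.
  by rewrite mulN1r addNr.
have fE x : mxmemL2 mu x -> mxinner mu f x = mxinner mu p x + mxinner mu r x.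
  by move=> xL; rewrite mxinner_lincomb// mulN1r addrA subrr add0r.
set h := (\matrix_(l, m) _).
have vE l : lattice_coef mu h psi l = c k0 l.
  apply/funext => z; have qzL := mxshift_memL2 (val z) (qL l).
  have -> : lattice_coef mu h psi l z = mxinner mu f (mxshift (val z) (q l)).
    by rewrite mxinner_row_embed//; apply: eq_bigr => m _; rewrite !mxE.
  (* r is orthogonal to the shifts of q l *)
  have -> : mxinner mu f (mxshift (val z) (q l)) =
      mxinner mu p (mxshift (val z) (q l)).
    rewrite fE// -[X in _ + X]mxinner_shift_adj//.
    rewrite -((D_adjoint (bL l)).2 _ (mxshift_adj_memL2 (val z) rL)).
    rewrite [X in _ + X]mxinner0l ?addr0// => i j.
    by apply/funext => w; rewrite analysis_shift_adj// Cr0 mulr0.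
  rewrite (mxinnerJ qzL pL) -padj// (analysis_mxshift_dirac z (qL l) (Cq l)).
  by rewrite -mxinnerJ ?mxinner_dirac_mx//; exact: dirac_mx_memL2.
split=> [l|l|]; [by rewrite uE|by rewrite vE|].
have fp : mxinner mu f p = (mxenergy mu p)%:C.
  by rewrite fE// -(padj r)// [X in _ + X]mxinner0l// addr0 mxinner_self.
exists (mxenergy mu p).
  rewrite mxenergy_ge0 -mxenergy_row_embed//=.
  have := Re_mxinner_le ltr01 fL pL; rewrite fp Re_real invr1 !mul1r -/f.
  by lra.
rewrite -fp -padj//; apply/esym.
rewrite /mxinner (bigD1 k0)//= [X in _ + X]big1 ?addr0 => [|k kk0].
  by apply: eq_bigr => l _; rewrite uE vE.
by rewrite big1// => l _; rewrite Cf0// inner0l.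
Qed.
End adjoint.
End riesz_sequences.

(** * Joint measurability *)

Section joint_measurability.
Variables (R : realType) (G : topologicalZmodType).
Hypothesis G_second_countable : @second_countable G.

Lemma countable_basis : exists B : nat -> set G, (forall k, open (B k)) /\
  forall x U, nbhs x U -> exists2 k, B k x & B k `<=` U.
Proof.
have [B cB [oB bB]] := G_second_countable.
have /pfcard_geP[B0|/unsquash f] := cB.
  exists (fun=> setT); split=> [k|x U /(bB x)]; first exact: openT.
  by move=> [V [BV _]]; rewrite B0 in BV.
exists f; split=> [k|x U /(bB x) [V [BV Vx] VU]].
  by apply: oB; exact: funS.
by have [k _ fkV] := @surj _ _ _ _ f V BV; exists k; rewrite fkV.
Qed.

Lemma continuous2_measurable (f : G * G -> G) : continuous f ->
  measurable_fun setT (f : borel G * borel G -> borel G).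
Proof.
move=> cf; have [B [oB bB]] := countable_basis.
apply: (@measurability _ _ (borel G * borel G)%type (borel G) setT f (@open G)) => //.
move=> _ [U oU <-]; rewrite setTI.
rewrite (_ : f @^-1` U = \bigcup_i \bigcup_(j in [set j | B i `*` B j `<=` f @^-1` U])
    (B i `*` B j)); last first.
  apply/seteqP; split=> [[x y] Uxy|z [i _ [j ij zij]]]; last exact: ij.
  have [[V W] /= [Vx Wy] VWU] := cf (x, y) U (open_nbhs_nbhs (conj oU Uxy)).
  have [i Bx BV] := bB _ _ Vx; have [j By BW] := bB _ _ Wy.
  exists i => //; exists j => //= -[s t] /= [Bs Bt].
  by apply: VWU; split; [exact: BV|exact: BW].
apply: bigcupT_measurable => i; apply: bigcup_measurable => j _.
by apply: measurableX; exact: open_borel.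
Qed.

(** If f(x, y) > a then f(., y) stays above a + 1/(m+1) on some basic
    neighborhood B_k of x. So {f > a} is the countable union over k and m of
    the rectangles B_k x E_(k,m), where E_(k,m) is the set of the y such that
    f(., y) >= a + 1/(m+1) on B_k; it is closed by continuity in y. In the
    application, the first space is the group and the second one its dual. *)
Lemma separately_continuous_measurable (H : PreTopologicalZmodule.type)
    (f : G -> H -> R) :
  (forall y, continuous (f^~ y)) -> (forall x, continuous (f x)) ->
  measurable_fun setT (fun z : borel G * borel H => f z.1 z.2).
Proof.
move=> cf1 cf2; have [B [oB bB]] := countable_basis.
apply: (measurability _ (RGenOInfty.measurableE R)) => //.
move=> _ [_ [a ->] <-]; rewrite setTI.
pose E k m := [set y | forall x, B k x -> a + m.+1%:R^-1 <= f x y].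
rewrite (_ : _ @^-1` _ = \bigcup_k \bigcup_m (B k `*` E k m)); last first.
  apply/seteqP; split=> [[x y] /=|[x y] [k _ [m _ [/= Bx /(_ x Bx)]]]].
    rewrite in_itv /= andbT => axy.
    pose m := Num.truncn ((f x y - a) / 2)^-1.
    have m0 : m.+1%:R^-1 <= (f x y - a) / 2.
      rewrite -[leRHS]invrK lef_pV2 ?posrE ?invr_gt0 ?divr_gt0 ?subr_gt0//.
      exact/ltW/truncnS_gt.
    have m1 : 0 < (m.+1%:R^-1 : R) by rewrite invr_gt0.
    have /cvgrPdist_lt /(_ _ m1) /bB[k Bx Bk] := cf1 y x.
    exists k => //; exists m => //; split=> //= t /Bk /=.
    rewrite ltr_norml => /andP[_ h].
    have {h} : f x y - f t y < m.+1%:R^-1 by [].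
    by move: m0; set i := m.+1%:R^-1; lra.
  rewrite /= in_itv /= andbT; apply: lt_le_trans.
  by rewrite ltrDl invr_gt0.
apply: bigcupT_measurable => k; apply: bigcupT_measurable => m.
apply: measurableX; first exact: open_borel.
apply: closed_borel; rewrite (_ : E k m =
    \bigcap_(x in B k) (f x @^-1` [set r | a + m.+1%:R^-1 <= r])); last first.
  by apply/seteqP; split.
apply: closed_bigI => x Bx; apply: closed_comp; last exact: closed_ge.
by move=> y _; exact: cf2.
Qed.

(** Evaluation at t is continuous for the compact-open topology because
    singletons are compact. *)
Lemma continuous_dual_eval (t : G) :
  continuous ((fun w : dual R G => w t) : dual R G -> R[i]^o).
Proof.
move=> w A /= nA.
have nAw : nbhs (char_fun w : {compact-open, G -> R[i]^o}) [set f | A (f t)].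
  have [V [oV Vw VA]] : exists V : set R[i]^o, [/\ open V, V (w t) & V `<=` A].
    by move: nA; rewrite nbhsE => -[V [oV Vw] VA]; exists V.
  apply: (@filterS _ _ _ [set f | f @` [set t] `<=` V]).
    by move=> f /= fV; apply/VA/fV; exists t.
  apply: open_nbhs_nbhs; split.
    by apply: compact_open_open => //; exact: compact_set1.
  by move=> _ /= [_ -> <-].
exact: (@initial_continuous (dual R G) {compact-open, G -> R[i]^o}
  (@char_fun R G) w _ nAw).
Qed.

Lemma dual_eval_cmeasurable :
  cmeasurable (fun z : borel G * borel (dual R G) => (z.2 : dual R G) z.1).
Proof.
split.
- apply: (@separately_continuous_measurable _ (fun t (w : dual R G) => Re (w t))).
    by move=> w; apply: continuous_Re; exact: char_continuous.
  by move=> t; apply: continuous_Re; exact: continuous_dual_eval.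
- apply: (@separately_continuous_measurable _ (fun t (w : dual R G) => Im (w t))).
    by move=> w; apply: continuous_Im; exact: char_continuous.
  by move=> t; apply: continuous_Im; exact: continuous_dual_eval.
Qed.
End joint_measurability.

Lemma cmeasurable_comp d1 d2 (T1 : measurableType d1) (T2 : measurableType d2)
    (R : realType) (f : T2 -> R[i]) (p : T1 -> T2) :
  cmeasurable f -> measurable_fun setT p -> cmeasurable (f \o p).
Proof.
move=> [mr mi] mp; split; first exact: (measurableT_comp mr mp).
exact: (measurableT_comp mi mp).
Qed.

Lemma measurable_parametric_integral d1 d2 (T1 : measurableType d1)
    (T2 : measurableType d2) (R : realType)
    (m : {sigma_finite_measure set T2 -> \bar R}) (k : T1 * T2 -> R) :
  measurable_fun setT k -> measurable_fun setT (fun x => \int[m]_t k (x, t)).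
Proof.
move=> /measurable_EFinP mk.
apply: (measurableT_comp (fine_measurable measurableT)) => /=.
under eq_fun do rewrite integralE.
apply: emeasurable_funB.
- have := measurable_fun_fubini_tonelli_F (m2 := m) _ (measurable_funepos mk)
    (fun z => funepos_ge0 _ z).
  apply: eq_measurable_fun => x _; apply: eq_integral => t _.
  by rewrite !funeposE.
- have := measurable_fun_fubini_tonelli_F (m2 := m) _ (measurable_funeneg mk)
    (fun z => funeneg_ge0 _ z).
  apply: eq_measurable_fun => x _; apply: eq_integral => t _.
  by rewrite !funenegE.
Qed.

Lemma cmeasurable_parametric_integral d1 d2 (T1 : measurableType d1)
    (T2 : measurableType d2) (R : realType)
    (m : {sigma_finite_measure set T2 -> \bar R}) (k : T1 * T2 -> R[i]) :
  cmeasurable k -> cmeasurable (fun x => cintegral m (fun t => k (x, t))).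
Proof.
move=> [mr mi]; split; first exact: (measurable_parametric_integral m mr).
exact: (measurable_parametric_integral m mi).
Qed.

(** * Moyal's relation for the short-time Fourier transform *)

Section moyal.
Variables (R : realType) (G : topologicalZmodType).
Hypothesis G_second_countable : @second_countable G.
Variables (mu : {sigma_finite_measure set (borel G) -> \bar R})
          (muhat : {sigma_finite_measure set (borel (dual R G)) -> \bar R}).
Hypotheses (mu_haar : haar_measure mu) (mu_muhat : plancherel mu muhat).
Variables (A : set (borel G)) (mA : measurable A) (Afin : (mu A < +oo)%E).

(** The analysed function phi. An indicator function of a set of finite
    measure keeps phi(t) conj(h(t - x)) both integrable and square integrable,
    which Plancherel's theorem asks for. *)
Definition indic_fun : G -> R[i] := fun t => (\1_A t : R)%:C.

Lemma normsq_indic_fun t : normsq (indic_fun t) = \1_A t.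
Proof.
by rewrite /normsq /= indicE expr0n addr0; case: (_ \in _); rewrite ?expr1n ?expr0n.
Qed.

Lemma indic_fun_energy : energy mu indic_fun = mu A.
Proof.
rewrite /energy; under eq_integral do rewrite normsq_indic_fun.
by rewrite integral_indic// setIT.
Qed.

Lemma indic_fun_memL2 : memL mu 2%:E indic_fun.
Proof.
apply/memL2P; rewrite indic_fun_energy; split=> //.
by split; [exact: measurable_indic|exact: measurable_cst].
Qed.

Lemma stft_cmeasurable (h : G -> R[i]) : cmeasurable (h : borel G -> R[i]) ->
  cmeasurable (stft mu h indic_fun :
    (borel G * borel (dual R G))%type -> R[i]).
Proof.
move=> mh; have [mi _] := indic_fun_memL2.
pose T := ((borel G * borel (dual R G)) * borel G)%type.
pose k (y : T) := indic_fun y.2 * ((y.1.2 : dual R G) y.2 * h (y.2 - y.1.1))^*.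
apply: (@cmeasurable_parametric_integral _ _ _ _ _ _ k).
apply: cmeasurableM; first exact: (cmeasurable_comp mi measurable_snd).
apply/cmeasurableJ/cmeasurableM.
  apply: (cmeasurable_comp (dual_eval_cmeasurable R G_second_countable)
    (p := fun y : T => (y.2, y.1.2))).
  apply: measurable_fun_pair; first exact: measurable_snd.
  by apply: measurableT_comp; [exact: measurable_snd|exact: measurable_fst].
apply: (cmeasurable_comp mh (p := fun y : T => y.2 - y.1.1 : borel G)).
have cB : continuous (fun z : G * G => z.1 - z.2) by exact: sub_continuous.
apply: (measurableT_comp (continuous2_measurable G_second_countable cB)
  (g := fun y : T => (y.2, y.1.1))).
apply: measurable_fun_pair; first exact: measurable_snd.
by apply: measurableT_comp; [exact: measurable_fst|exact: measurable_fst].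
Qed.

Lemma memL2_shift x (h : G -> R[i]) : memL mu 2%:E h ->
  memL mu 2%:E (fun t => h (t - x)).
Proof.
move=> /(memL2_tfshift mu_haar (x, 0)); congr memL.
by apply/funext => t; rewrite /tfshift /= mul1r.
Qed.

(** For fixed x the function stft(x, .) is the Fourier transform of
    1_A(t) conj(h(t - x)), so Plancherel integrates out the frequency. *)
Lemma stft_frequency_energy x (h : G -> R[i]) : memL mu 2%:E h ->
  (\int[muhat]_w (normsq (stft mu h indic_fun (x, w)))%:E =
   \int[mu]_t (\1_A t * normsq (h (t - x)))%:E)%E.
Proof.
move=> hL; have hxL := memL2_shift x hL.
pose k (t : G) := indic_fun t * (h (t - x))^*.
have kE t : normsq (k t) = \1_A t * normsq (h (t - x)).
  by rewrite normsqM normsqJ normsq_indic_fun.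
have k1 : memL mu 1%:E k.
  by apply/memL1P; exact: (cintegrable_mulJ indic_fun_memL2 hxL).
have mk : cmeasurable (k : borel G -> R[i]) by case: k1.
have k2 : memL mu 2%:E k.
  apply/memL2P; split=> //; have /memL2P[mhx] := hxL; apply: le_lt_trans.
  apply: ge0_le_integral => //.
  - by move=> t _; rewrite lee_fin normsq_ge0.
  - exact/measurable_EFinP/measurable_normsq.
  - exact/measurable_EFinP/measurable_normsq.
  - move=> t _; rewrite lee_fin kE; apply: ler_piMl; first exact: normsq_ge0.
    by rewrite indicE; case: (_ \in _).
transitivity (energy muhat (fourier mu k)).
  apply: eq_integral => w _; congr (normsq _)%:E; apply: eq_cintegral => t.
  by rewrite conjM /k; ring.
rewrite -cLnorm2_sq (mu_muhat k1 k2) cLnorm2_sq.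
by apply: eq_integral => t _; rewrite kE.
Qed.

(** After [stft_frequency_energy], translating t by x leaves
    1_A(t + x) |h(t)|^2, whose integral over x is mu A |h(t)|^2. *)
Lemma stft_energy (h : G -> R[i]) : memL mu 2%:E h ->
  energy (mu \x muhat)%E (stft mu h indic_fun) = (mu A * energy mu h)%E.
Proof.
move=> hL; have [mh _] := hL; have mF := stft_cmeasurable mh.
have mnh : measurable_fun setT (fun t : borel G => normsq (h t)).
  exact: measurable_normsq.
rewrite /energy fubini_tonelli1; last 2 first.
- exact/measurable_EFinP/measurable_normsq.
- by move=> z; rewrite lee_fin normsq_ge0.
pose Q (y : borel G * borel G) : \bar R :=
  (\1_A (y.2 + y.1) * normsq (h y.2))%:E.
have mQ : measurable_fun setT Q.
  apply/measurable_EFinP/measurable_funM; last exact: (measurableT_comp mnh).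
  have cD : continuous (fun z : G * G => z.2 + z.1).
    move=> z; rewrite (_ : (fun _ => _) = (fun z : G * G => z.1 + z.2)).
      exact: add_continuous.
    by apply/funext => y; rewrite addrC.
  apply: (measurableT_comp (f := \1_A : borel G -> R)); first exact: measurable_indic.
  exact: (continuous2_measurable G_second_countable cD).
have Q0 y : (0 <= Q y)%E by rewrite lee_fin mulr_ge0// normsq_ge0.
transitivity (\int[mu]_x \int[mu]_t Q (x, t))%E.
  apply: eq_integral => x _; rewrite /fubini_F stft_frequency_energy//.
  rewrite -(ge0_integral_shift mu_haar x _ (fun t => Q0 (x, t))); last first.
    exact: (measurableT_comp mQ (pair1_measurable x)).
  by apply: eq_integral => t _; rewrite /Q /= subrK.
rewrite fubini_tonelli//.
rewrite -ge0_integralZl//; last 2 first.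
- exact/measurable_EFinP.
- by move=> t _; rewrite lee_fin normsq_ge0.
apply: eq_integral => t _; rewrite /Q /=.
under eq_integral do rewrite mulrC EFinM.
rewrite ge0_integralZl//; last 2 first.
- apply/measurable_EFinP; apply: (measurableT_comp (f := \1_A : borel G -> R)).
    exact: measurable_indic.
  have := @measurable_shift G (- t); apply: eq_measurable_fun => x _.
  by rewrite opprK addrC.
- by rewrite lee_fin normsq_ge0.
rewrite muleC; congr (_ * _)%E.
transitivity (\int[mu]_x (\1_A x)%:E)%E; last by rewrite integral_indic// setIT.
rewrite -(ge0_integral_shift mu_haar (- t) (f := fun x => (\1_A x : R)%:E))//.
  by apply: eq_integral => x _; rewrite opprK addrC.
exact/measurable_EFinP/measurable_indic.
Qed.

Lemma stft_memL2 (h : G -> R[i]) : memL mu 2%:E h ->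
  memL (mu \x muhat)%E 2%:E (stft mu h indic_fun).
Proof.
move=> hL; apply/memL2P; split; first exact: stft_cmeasurable hL.1.
rewrite stft_energy//; apply: lte_mul_pinfty => //; last by have /memL2P[] := hL.
by rewrite ge0_fin_numE.
Qed.

(** Moyal's orthogonality relation, obtained from [stft_energy] by
    polarization. *)
Lemma Re_inner_stft (h1 h2 : G -> R[i]) :
  memL mu 2%:E h1 -> memL mu 2%:E h2 ->
  Re (inner (mu \x muhat)%E (stft mu h1 indic_fun) (stft mu h2 indic_fun)) =
  fine (mu A) * Re (inner mu h1 h2).
Proof.
move=> h1L h2L; have F1 := stft_memL2 h1L; have F2 := stft_memL2 h2L.
have hL := memL2D h1L h2L.
have muAfin : mu A \is a fin_num by rewrite ge0_fin_numE.
have FD : stft mu (fun t => h1 t + h2 t) indic_fun =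
    (fun xi => stft mu h1 indic_fun xi + stft mu h2 indic_fun xi).
  apply/funext => xi; rewrite /stft -innerDr//; try exact: memL2_tfshift.
    by apply: eq_cintegral => t; rewrite /tfshift mulrDr.
  exact: indic_fun_memL2.
have := energyD F1 F2; rewrite -FD !stft_energy// !fineM ?memL2_fin_num//.
rewrite energyD//; lra.
Qed.
End moyal.

(** * The density inequality *)

Lemma sigma_finite_pos_measure d (T : measurableType d) (R : realType)
    (mu : {sigma_finite_measure set T -> \bar R}) :
  mu setT <> 0%E -> exists A, [/\ measurable A, (0 < mu A)%E & (mu A < +oo)%E].
Proof.
move=> muT; apply: contrapT => noA; apply: muT.
have [F FT mF] := sigma_finiteT mu.
rewrite FT; apply/negligibleP; first by apply: bigcup_measurable => k _; case: (mF k).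
apply: negligible_bigcup => k; have [mFk Fky] := mF k; apply/negligibleP => //.
apply: contrapT => Fk0; apply: noA; exists (F k); split=> //.
by rewrite lt0e measure_ge0 andbT; exact/eqP.
Qed.

Section lower_integral.
Import HBNNSimple.

(** The integral of a nonnegative function is the supremum of the integrals of
    the simple functions below it, so it is monotone on arbitrary nonnegative
    functions, such as the sums over the cosets of a lattice. *)
Lemma ge0_le_lower_integral d (T : measurableType d) (R : realType)
    (nu : {measure set T -> \bar R}) (f h : T -> \bar R) :
  (forall x, 0 <= f x <= h x)%E -> (\int[nu]_x f x <= \int[nu]_x h x)%E.
Proof.
move=> fh; have f0 x : (0 <= f x)%E by case/andP: (fh x).
have h0 x : (0 <= h x)%E by case/andP: (fh x) => ? ?; exact: le_trans (f0 x) _.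
rewrite !ge0_integralTE//; apply: ereal_sup_le => _ [s /= sf <-].
exists s => //= x.
by apply: le_trans (sf x) _; case/andP: (fh x).
Qed.

End lower_integral.

Section density.
Variables (R : realType) (G : topologicalZmodType).
Hypothesis G_second_countable : @second_countable G.
Variables (mu : {sigma_finite_measure set (borel G) -> \bar R})
          (muhat : {sigma_finite_measure set (borel (dual R G)) -> \bar R}).
Hypotheses (mu_haar : haar_measure mu) (mu_muhat : plancherel mu muhat).
Variable L : zmodClosed (G * dual R G)%type.
Variable nu : {measure set (borel (phase_quot L)) -> \bar R}.
Hypothesis nu_weil : weil mu muhat nu.
Variables (n d : nat) (g h : 'M[G -> R[i]]_(n, d)).
Hypotheses (gL2 : mxmemL2 mu g) (hL2 : mxmemL2 mu h).

(** On the coset of xi, the sum over l and over the lattice of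
    F_(g_lj) conj(F_(h_lj)) is the value of the quadratic form of
    [positive_contraction] at the vector with entry [tfshift_adj xi phi] in
    column j and 0 elsewhere, hence lies between 0 and mu A. Weil's formula
    integrates this bound to mu A times sigma, while Moyal's relation evaluates
    the integral over the phase space; A only serves to define phi, and mu A
    cancels. *)
Lemma biorthogonal_column_bound (A : set (borel G)) (sigma : R) (j : 'I_d) :
  positive_contraction mu L g h ->
  measurable A -> (0 < mu A < +oo)%E -> lattice_size nu = sigma%:E ->
  \sum_l Re (inner mu (g l j) (h l j)) <= sigma.
Proof.
move=> gh mA /andP[A0 Ay] nuE.
have muAfin : mu A \is a fin_num by rewrite ge0_fin_numE.
have alpha0 : 0 < fine (mu A) by rewrite fine_gt0// A0.
have phiL : memL mu 2%:E (indic_fun R A) by exact: indic_fun_memL2.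
have phiE : energy mu (indic_fun R A) = mu A by exact: indic_fun_energy.
set phi := indic_fun R A in phiL phiE.
have gF l : memL (mu \x muhat)%E 2%:E (stft mu (g l j) phi).
  exact: stft_memL2 (gL2 l j).
have hF l : memL (mu \x muhat)%E 2%:E (stft mu (h l j) phi).
  exact: stft_memL2 (hL2 l j).
pose F (xi : G * dual R G) : R[i] :=
  \sum_l stft mu (g l j) phi xi * (stft mu (h l j) phi xi)^*.
have iF l : cintegrable (mu \x muhat)%E
    (fun xi => stft mu (g l j) phi xi * (stft mu (h l j) phi xi)^*).
  exact: cintegrable_mulJ.
have F1 : memL (mu \x muhat)%E 1%:E F by apply/memL1P; exact: cintegrable_sum.
have ReF : Re (cintegral (mu \x muhat)%E F) =
    fine (mu A) * \sum_l Re (inner mu (g l j) (h l j)).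
  rewrite cintegral_sum// Re_sum mulr_sumr; apply: eq_bigr => l _.
  exact: (Re_inner_stft G_second_countable mu_haar mu_muhat).
have fibre (q : phase_quot L) : exists2 s : R, 0 <= s <= fine (mu A) &
    lattice_sum (fun l : points L => F (repr q + val l)) = s%:C.
  set xi : G * dual R G := repr q.
  pose psi (m : 'I_d) : G -> R[i] :=
    if m == j then tfshift_adj xi phi else (fun=> 0).
  have psiL m : memL mu 2%:E (psi m).
    rewrite /psi; case: eqP => _; last exact: memL20.
    exact: memL2_tfshift_adj.
  have [uL vL [s s01 sE]] := gh psi psiL.
  have psi_sum (k : 'M[G -> R[i]]_(n, d)) l z : mxmemL2 mu k ->
      lattice_coef mu k psi l z =
      (val z).2 xi.1 * stft mu (k l j) phi (xi + val z).
    move=> kL; rewrite /lattice_coef (bigD1 j)//= big1 ?addr0 => [|m /negbTE mj].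
      by rewrite /psi eqxx inner_adj_tfshift.
    by rewrite /psi mj inner0l.
  exists s.
    case/andP: s01 => -> /= /le_trans -> //.
    rewrite (bigD1 j)//= big1 ?addr0 => [|m /negbTE mj].
      by rewrite /psi eqxx energy_tfshift_adj// phiE.
    by rewrite /psi mj energy0.
  rewrite -sE /inner -cintegral_sum => [|l]; last exact: (cintegrable_mulJ (uL l) (vL l)).
  apply: eq_cintegral => z; apply: eq_bigr => l _.
  (* the phases of both factors cancel *)
  rewrite !psi_sum// conjM mulrACA.
  by rewrite (normsq1_mulJ (char_normsq _ _)) mul1r.
have := congr1 (@Re R) (nu_weil F1); rewrite ReF Re_cintegral.
pose s (q : phase_quot L) : R :=
  Re (lattice_sum (fun l : points L => F (repr q + val l))).
have s01 q : 0 <= s q <= fine (mu A).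
  by rewrite /s; have [r r01 ->] := fibre q.
have intA : (\int[nu]_q (fine (mu A))%:E = (fine (mu A) * sigma)%:E)%E.
  rewrite -[(fine (mu A))%:E]mule1 ge0_integralZl//=; last by rewrite lee_fin ltW.
  by rewrite -[X in (_ * X)%E]/(lattice_size nu) nuE EFinM.
move=> Fs; rewrite -(ler_pM2l alpha0) Fs -lee_fin -intA.
have le_s : (\int[nu]_q (s q)%:E <= \int[nu]_q (fine (mu A))%:E)%E.
  by apply: ge0_le_lower_integral => q; rewrite !lee_fin.
rewrite /Rintegral fineK// ge0_fin_numE.
  by apply: le_lt_trans le_s _; rewrite intA ltry.
by apply: integral_ge0 => q _; rewrite lee_fin; case/andP: (s01 q).
Qed.
End density.

Theorem proposition4p36
  (R : realType) (G : topologicalZmodType)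
  (G_hausdorff : hausdorff_space G)
  (G_locally_compact : locally_compact [set: G])
  (G_second_countable : @second_countable G)
  (mu : {sigma_finite_measure set (borel G) -> \bar R})
  (muhat : {sigma_finite_measure set (borel (dual R G)) -> \bar R})
  (mu_haar : haar_measure mu) (muhat_haar : haar_measure muhat)
  (mu_muhat_plancherel : plancherel mu muhat)
  (L : zmodClosed (G * dual R G)%type) (L_lattice : is_lattice L)
  (nu : {measure set (borel (phase_quot L)) -> \bar R})
  (nu_haar : haar_measure nu) (nu_weil : weil mu muhat nu)
  (n d : nat) (n_gt0 : (0 < n)%N) (d_gt0 : (0 < d)%N)
  (g : 'M[G -> R[i]]_(n, d))
  (g_heisenberg : forall i j, heisenberg mu muhat L (g i j)) :
  matrix_gabor_riesz mu L g ->
  ((n%:R / d%:R)%:E <= lattice_size nu)%E.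
Proof.
move=> [D D_adj CD_iso].
have gL2 : mxmemL2 mu g by move=> i j; case: (g_heisenberg i j).
have [h [hL2 hg gh]] :=
  dual_window mu_haar gL2 D_adj CD_iso (Ordinal n_gt0).
have [_ _ /sigma_finite_pos_measure[A [mA A0 Ay]]] := mu_haar.
have nu0 : (0 <= lattice_size nu)%E by apply: integral_ge0.
have [nuy|nufin] := eqVneq (lattice_size nu) +oo%E; first by rewrite nuy leey.
have nuE : lattice_size nu = (fine (lattice_size nu))%:E.
  by rewrite fineK// ge0_fin_numE// lt_neqAle nufin leey.
rewrite nuE lee_fin ler_pdivrMr ?ltr0n// mulrC.
set sigma := fine _ in nuE *.
have col j : \sum_l Re (inner mu (g l j) (h l j)) <= sigma.
  have A0y : (0 < mu A < +oo)%E by rewrite A0.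
  exact: (biorthogonal_column_bound G_second_countable mu_haar
    mu_muhat_plancherel nu_weil gL2 hL2 j gh mA A0y nuE).
have -> : n%:R = \sum_(j < d) \sum_(l < n) Re (inner mu (g l j) (h l j)).
  rewrite exchange_big -[in LHS](card_ord n) -sumr_const.
  apply: eq_bigr => l _; rewrite -Re_sum.
  suff -> : \sum_m inner mu (g l m) (h l m) = 1 by [].
  rewrite -[RHS]conjC1 -(hg l) rmorph_sum; apply: eq_bigr => m _.
  exact: (innerJ (hL2 l m) (gL2 l m)).
have -> : d%:R * sigma = \sum_(j < d) sigma by rewrite sumr_const card_ord mulr_natl.
by apply: ler_sum.
Qed.
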